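(* Let $A{_\tau\times_\sigma}B$ be a smash biproduct bialgebra for which $\sigma$ is right conormal. Suppose that there exist normalized elements $W=\sum W^1\otimes W^2\in B\otimes B$, $X=\sum X^1\otimes X^2\in A\otimes B$, $Y=\sum Y^1\otimes Y^2\in B\otimes A$ and $Z=\sum Z^1\otimes Z^2\in A\otimes A$ satisfying the following identities C1)–C19) for all $a\in A$, $b\in B$: C1) $\sum Z^1_{\tau_1\tau_2}\bar X^1_{\tau_3}X^1a_{(1)\sigma_3}\,\epsilon_B((W^1Y^1)_{\sigma_3})\otimes Z^2Y^2_{\sigma_1\sigma_2}a_{(2)\sigma_4}\,\epsilon_B(1_{B\tau_1\sigma_2}\bar X^2_{\sigma_1})\,\epsilon_B((1_{B\tau_2}1_{B\tau_3}X^2W^2)_{\sigma_4})=\sum a_{(2)\tau}Z^1\otimes a_{(1)}Z^2_\sigma\,\epsilon_B(1_{B\tau\sigma})$; C2) $\sum X^1a_\sigma\,\epsilon_B(W^1_\sigma)\otimes X^2W^2=\sum a_\tau X^1\otimes 1_{B\tau}X^2$; C3) $\sum W^1Y^11_{B\tau}\otimes Y^2a_{\tau\sigma}\,\epsilon_B(W^2_\sigma)=\sum Y^1\otimes aY^2$; C4) $\sum Z^1\otimes Z^2\epsilon_B(b)=\sum 1_{A\tau}Z^1_{\sigma_1}\otimes Z^2_{\sigma_2}\,\epsilon_B(b_{(1)\tau\sigma_2})\,\epsilon_B(b_{(2)\sigma_1})$; C5) $\sum X^1\otimes X^2b=\sum 1_{A\tau}X^1_\sigma\,\epsilon_B(b_{(2)\sigma})\otimes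 b_{(1)\tau}X^2$; C6) $\sum W^1Y^1b_\tau\otimes Y^21_{A\tau\sigma}\,\epsilon_B(W^2_\sigma)=\sum b_\sigma Y^1\otimes Y^2_\sigma$; C7) $\sum W^1b_{(1)}\otimes W^2b_{(2)}=\sum b_{(2)}W^1\otimes b_{(1)}W^2$; C8) $\sum Z^1_{(1)}\otimes Z^1_{(2)}\otimes Z^2=\sum Z^1_\tau X^1\otimes\bar Z^1\otimes Z^2\bar Z^2_\sigma\,\epsilon_B((1_{B\tau}X^2)_\sigma)$; C9) $\sum X^1_{(1)}\otimes X^1_{(2)}\otimes X^2=\sum X^1\otimes\bar X^1\otimes X^2\bar X^2$; C10) $\sum Y^1_{\tau_1}\otimes(Z^1_{\tau_2}X^1)_{\tau_1}\otimes Z^2Y^2_\sigma\,\epsilon_B((1_{B\tau_2}X^2)_\sigma)=\sum W^1Y^1\otimes Z^1\otimes Y^2Z^2_\sigma\,\epsilon_B(W^2_\sigma)$; C11) $\sum W^1_\tau\otimes X^1_\tau\otimes X^2W^2=\sum W^1\otimes X^1\otimes W^2X^2$; C12) $\sum Y^1_{(1)}\otimes Y^1_{(2)}\otimes Y^2=\sum W^1Y^1\otimes\bar Y^1\otimes Y^2\bar Y^2_\sigma\,\epsilon_B(W^2_\sigma)$; C13) $\sum W^1_{(1)}\otimes W^1_{(2)}\otimes W^2=\sum W^1\otimes\bar W^1\otimes W^2\bar W^2$; C14) $\sum Z^1\otimes Z^2_{(1)}\otimes Z^2_{(2)}=\sum Z^1_\tau X^1\bar Z^1_{\sigma_1}\,\epsilon_B(Y^1_{\sigma_1})\otimes\bar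 Z^2\otimes Z^2Y^2_{\sigma_2}\,\epsilon_B((1_{B\tau}X^2)_{\sigma_2})$; C15) $\sum Z^1_{\tau_1}X^1\otimes(1_{B\tau_1}X^2)_{\tau_2}\otimes Z^2_{\tau_2}=\sum Z^1_\tau X^1\bar X^1_{\sigma_1}\,\epsilon_B(Y^1_{\sigma_1})\otimes\bar X^2\otimes Z^2Y^2_{\sigma_2}\,\epsilon_B((1_{B\tau}X^2)_{\sigma_2})$; C16) $\sum X^1\otimes X^2_{(1)}\otimes X^2_{(2)}=\sum X^1\bar X^1_\sigma\,\epsilon_B(W^1_\sigma)\otimes\bar X^2\otimes X^2W^2$; C17) $\sum Y^1\otimes Y^2_{(1)}\otimes Y^2_{(2)}=\sum Y^1\bar Y^1\otimes\bar Y^2\otimes Y^2$; C18) $\sum W^1Y^1\otimes W^2_\tau\otimes Y^2_\tau=\sum Y^1W^1\otimes W^2\otimes Y^2$; C19) $\sum W^1\otimes W^2_{(1)}\otimes W^2_{(2)}=\sum W^1\bar W^1\otimes\bar W^2\otimes W^2$. Then $$\alpha=\sum Z^1_{\tau_1\tau_2}\bar X^1_{\tau_3}X^1\otimes W^1Y^1\otimes Z^2Y^2_{\sigma_1\sigma_2}\,\epsilon_B(1_{B\tau_1\sigma_2}\bar X^2_{\sigma_1})\otimes 1_{B\tau_2}1_{B\tau_3}X^2W^2$$ is a quasitriangular structure of $A{_\tau\times_\sigma}B$.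
   Context: Everything is over a field $\Bbbk$. Algebras are associative and unital, coalgebras coassociative and counital; $\Delta(c)=\sum c_{(1)}\otimes c_{(2)}$. Smash product: for algebras $A,B$ and a linear map $\sigma:B\otimes A\to A\otimes B$, written $\sigma(b\otimes a)=\sum a_\sigma\otimes b_\sigma$, consider on $A\otimes B$ the multiplication $(a\otimes b)(a'\otimes b')=\sum aa'_\sigma\otimes b_\sigma b'$. If it is associative with unit $1_A\otimes 1_B$, this algebra is the smash product $A\#_\sigma B$. Smash coproduct: for coalgebras $A,B$ and a linear map $\tau:A\otimes B\to B\otimes A$, written $\tau(a\otimes b)=\sum b_\tau\otimes a_\tau$, consider on $A\otimes B$ the comultiplication $a\otimes b\mapsto\sum a_{(1)}\otimes b_{(1)\tau}\otimes a_{(2)\tau}\otimes b_{(2)}$. If it is coassociative with counit $\epsilon_A\otimes\epsilon_B$, this coalgebra is the smash coproduct $A{_\tau\ltimes}B$. Smash biproduct: if $A,B$ are both algebras and coalgebras (neither necessarily a bialgebra), $A\#_\sigma B$ is a smash product, $A{_\tau\ltimes}B$ is a smash coproduct, and $A\otimes B$ with these two structures is a bialgebra, this bialgebra is denoted $A{_\tau\times_\sigma}B$ and called a smash biproduct bialgebra. Standing assumption: for every smash biproduct bialgebra, $A$ and $B$ are counital algebras via $\epsilon_A,\epsilon_B$ (i.e. $\epsilon_A,\epsilon_B$ are algebra maps to $\Bbbk$) and unital coalgebras via $\eta_A,\eta_B$ (i.e. the unit maps $\Bbbk\to A$, $\Bbbk\to B$ are coalgebra maps). $\sigma$ is right conormal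 if $\sum\epsilon_A(a_\sigma)b_\sigma=\epsilon_A(a)b$ for all $a\in A,b\in B$. A quasitriangular structure of a bialgebra $H$ is an element $\mathcal R=\sum\mathcal R^1\otimes\mathcal R^2\in H\otimes H$ (not required invertible) with: (QT1) $(\epsilon_H\otimes id)(\mathcal R)=1_H=(id\otimes\epsilon_H)(\mathcal R)$; (QT2) $(\Delta_H\otimes id)(\mathcal R)=\mathcal R_{13}\mathcal R_{23}$; (QT3) $(id\otimes\Delta_H)(\mathcal R)=\mathcal R_{13}\mathcal R_{12}$; (QT4) $\mathcal R\Delta_H(h)=\Delta_H^{cop}(h)\mathcal R$ for all $h\in H$. For $H=A{_\tau\times_\sigma}B$, $H\otimes H=A\otimes B\otimes A\otimes B$. Normalized elements: $W\in B\otimes B$ is normalized if $\sum\epsilon_B(W^1)W^2=1_B=\sum W^1\epsilon_B(W^2)$; $X\in A\otimes B$ if $\sum\epsilon_A(X^1)X^2=1_B$ and $\sum X^1\epsilon_B(X^2)=1_A$; $Y\in B\otimes A$ if $\sum\epsilon_B(Y^1)Y^2=1_A$ and $\sum Y^1\epsilon_A(Y^2)=1_B$; $Z\in A\otimes A$ if $\sum\epsilon_A(Z^1)Z^2=1_A=\sum Z^1\epsilon_A(Z^2)$. Index notation: $\sigma_i$ (resp. $\tau_i$) is a copy of $\sigma$ (resp. $\tau$). If an index $\sigma_i$ appears on an element coming from $B$ and on an element coming from $A$, then $\sigma_i$ has been applied to ($B$-element)$\otimes$($A$-element); similarly $\tau_i$ is applied to ($A$-element)$\otimes$($B$-element). Several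 subscripts on one element are applied successively from left to right (including comultiplication subscripts $(1),(2)$); an index on a bracketed product applies to the product. Each occurrence of $1_A$ or $1_B$ carries its own indices. Decorated letters such as $\bar X=\sum\bar X^1\otimes\bar X^2$ denote further copies of the same element $X$ (likewise for $W,Y,Z$). For example, in $\alpha$: $\tau_1$ is applied to $Z^1\otimes 1_B$, then $\tau_2$ to $Z^1_{\tau_1}\otimes 1_B$; $\tau_3$ is applied to $\bar X^1\otimes 1_B$; $\sigma_1$ is applied to $\bar X^2\otimes Y^2$, then $\sigma_2$ to $1_{B\tau_1}\otimes Y^2_{\sigma_1}$. *)

(* Defs.v *)
From HB Require Import structures.
From mathcomp Require Import all_boot all_order all_algebra.
From mathcomp Require Import boolp.

Set Implicit Arguments.
Unset Strict Implicit.
Unset Printing Implicit Defensive.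

Import GRing.Theory.
Local Open Scope ring_scope.
Local Open Scope quotient_scope.

Reserved Notation "v ⊗ w" (at level 45, left associativity).
Reserved Notation "V ⨂ W" (at level 45, left associativity).
Reserved Notation "\tsum[ x , y <- t ] E"
  (at level 45, x name, y name, t at level 200, E at level 45,
   format "\tsum[ x ,  y  <-  t ]  E").

(* The tensor product of two (possibly infinite-dimensional) vector spaces is
   the quotient of the formal sums v_1 ⊗ w_1 + ... + v_n ⊗ w_n, represented as
   sequences of pairs, by the relation "every bilinear map takes the same value
   on both sums".  Scalars act on the left factors. *)
Section Tensor.
Variables (k : fieldType) (V W : lmodType k).

Definition tens_eq (s t : seq (V * W)) : Prop :=
  forall (U : lmodType k) (f : V -> W -> U), bilinear_for *:%R *:%R f ->
    \sum_(p <- s) f p.1 p.2 = \sum_(p <- t) f p.1 p.2.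

Definition tens_rel : rel (seq (V * W)) := fun s t => `[< tens_eq s t >].

Lemma tens_rel_refl : reflexive tens_rel.
Proof. by move=> s; apply/asboolP. Qed.

Lemma tens_rel_sym : symmetric tens_rel.
Proof.
by move=> s t; apply/asboolP/asboolP => H U f Hf; rewrite (H U f Hf).
Qed.

Lemma tens_rel_trans : transitive tens_rel.
Proof.
move=> t s r /asboolP H1 /asboolP H2; apply/asboolP => U f Hf.
by rewrite (H1 U f Hf) (H2 U f Hf).
Qed.

Canonical tens_equiv :=
  EquivRel tens_rel tens_rel_refl tens_rel_sym tens_rel_trans.

Definition tens : Type := {eq_quot tens_equiv}.
HB.instance Definition _ := Choice.on tens.
HB.instance Definition _ := EqQuotient.on tens.

Lemma tensP (s t : seq (V * W)) : \pi_tens s = \pi_tens t <-> tens_eq s t.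
Proof.
split=> [/eqmodP/asboolP //|H].
by apply/eqmodP/asboolP.
Qed.

Lemma repr_tens_eq (s : seq (V * W)) : tens_eq (repr (\pi_tens s)) s.
Proof. by apply/tensP; rewrite reprK. Qed.

Definition tens_add (s t : tens) : tens := \pi_tens (repr s ++ repr t).
Definition tens_scale (c : k) (t : tens) : tens :=
  \pi_tens [seq (c *: p.1, p.2) | p <- repr t].
Definition tens_zero : tens := \pi_tens [::].
Definition tens_opp (t : tens) : tens := tens_scale (-1) t.

Lemma bilin_scalel (U : lmodType k) (f : V -> W -> U) c v w :
  bilinear_for *:%R *:%R f -> f (c *: v) w = c *: f v w.
Proof. by case=> Hl _; exact: (scalable_linear (Hl w)). Qed.

Lemma tens_scaleE (U : lmodType k) (f : V -> W -> U) c (s : seq (V * W)) :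
  bilinear_for *:%R *:%R f ->
  \sum_(p <- [seq (c *: p.1, p.2) | p <- s]) f p.1 p.2
    = c *: \sum_(p <- s) f p.1 p.2.
Proof.
move=> Hf; rewrite big_map /= scaler_sumr.
by apply: eq_bigr => p _; rewrite (bilin_scalel _ _ _ Hf).
Qed.

Lemma sum_addE (U : lmodType k) (f : V -> W -> U) (s t : tens) :
  bilinear_for *:%R *:%R f ->
  \sum_(p <- repr (tens_add s t)) f p.1 p.2
    = \sum_(p <- repr s) f p.1 p.2 + \sum_(p <- repr t) f p.1 p.2.
Proof. by move=> Hf; rewrite (repr_tens_eq _ Hf) big_cat. Qed.

Lemma sum_scaleE (U : lmodType k) (f : V -> W -> U) c (t : tens) :
  bilinear_for *:%R *:%R f ->
  \sum_(p <- repr (tens_scale c t)) f p.1 p.2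
    = c *: \sum_(p <- repr t) f p.1 p.2.
Proof. by move=> Hf; rewrite (repr_tens_eq _ Hf) tens_scaleE. Qed.

Lemma sum_zeroE (U : lmodType k) (f : V -> W -> U) :
  bilinear_for *:%R *:%R f -> \sum_(p <- repr tens_zero) f p.1 p.2 = 0.
Proof. by move=> Hf; rewrite (repr_tens_eq _ Hf) big_nil. Qed.

Lemma tens_ext (s t : tens) :
  (forall (U : lmodType k) (f : V -> W -> U), bilinear_for *:%R *:%R f ->
    \sum_(p <- repr s) f p.1 p.2 = \sum_(p <- repr t) f p.1 p.2) -> s = t.
Proof. by move=> H; rewrite -[s]reprK -[t]reprK; apply/tensP. Qed.

Lemma tens_addA : associative tens_add.
Proof. by move=> r s t; apply: tens_ext => U f Hf; rewrite !sum_addE // addrA. Qed.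

Lemma tens_addC : commutative tens_add.
Proof. by move=> s t; apply: tens_ext => U f Hf; rewrite !sum_addE // addrC. Qed.

Lemma tens_add0 : left_id tens_zero tens_add.
Proof.
by move=> t; apply: tens_ext => U f Hf; rewrite sum_addE // sum_zeroE // add0r.
Qed.

Lemma tens_addN : left_inverse tens_zero tens_opp tens_add.
Proof.
move=> t; apply: tens_ext => U f Hf.
by rewrite sum_addE // sum_scaleE // sum_zeroE // scaleN1r addNr.
Qed.

HB.instance Definition _ :=
  GRing.isZmodule.Build tens tens_addA tens_addC tens_add0 tens_addN.

Lemma tens_scaleA a b t : tens_scale a (tens_scale b t) = tens_scale (a * b) t.
Proof. by apply: tens_ext => U f Hf; rewrite !sum_scaleE // scalerA. Qed.

Lemma tens_scale1 : left_id 1 tens_scale.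
Proof. by move=> t; apply: tens_ext => U f Hf; rewrite sum_scaleE // scale1r. Qed.

Lemma tens_scaleDr : right_distributive tens_scale +%R.
Proof.
move=> a s t; apply: tens_ext => U f Hf.
by rewrite sum_scaleE // !sum_addE // !sum_scaleE // scalerDr.
Qed.

Lemma tens_scaleDl t : {morph tens_scale^~ t : a b / a + b}.
Proof.
move=> a b; apply: tens_ext => U f Hf.
by rewrite sum_addE // !sum_scaleE // scalerDl.
Qed.

HB.instance Definition _ := GRing.Zmodule_isLmodule.Build k tens
  tens_scaleA tens_scale1 tens_scaleDr tens_scaleDl.

Definition tpure (v : V) (w : W) : tens := \pi_tens [:: (v, w)].

(* For bilinear F, [tsum t F] is the image of t under the linear map on the
   tensor product induced by F: see [tsum_tpure] and [tsum_linear], which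
   show that it does not depend on the representative of t. *)
Definition tsum (U : nmodType) (t : tens) (F : V -> W -> U) : U :=
  \sum_(p <- repr t) F p.1 p.2.

Lemma tsum_tpure (U : lmodType k) (F : V -> W -> U) v w :
  bilinear_for *:%R *:%R F -> tsum (tpure v w) F = F v w.
Proof. by move=> HF; rewrite /tsum (repr_tens_eq _ HF) big_seq1. Qed.

Lemma tsum_linear (U : lmodType k) (F : V -> W -> U) :
  bilinear_for *:%R *:%R F -> linear (fun t => tsum t F).
Proof. by move=> HF c s t; rewrite /tsum sum_addE // sum_scaleE. Qed.

Lemma tpure_bilinear : bilinear_for *:%R *:%R tpure.
Proof.
split=> u c v w; apply: tens_ext => U f Hf; rewrite sum_addE // sum_scaleE //;
  rewrite !(repr_tens_eq _ Hf) !big_seq1 /=.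
- exact: Hf.1.
- exact: Hf.2.
Qed.

Lemma tsum_id (t : tens) : tsum t tpure = t.
Proof.
rewrite -[RHS]reprK /tsum; elim: (repr t) => [|p s IH]; first by rewrite big_nil.
rewrite big_cons IH; apply/eqP; rewrite eqmodE; apply/asboolP => U f Hf.
by rewrite big_cat !(repr_tens_eq _ Hf) big_seq1 big_cons.
Qed.

End Tensor.

Notation "V ⨂ W" := (tens V W).
Notation "v ⊗ w" := (tpure v w) : ring_scope.
Notation "\tsum[ x , y <- t ] E" := (tsum t (fun x y => E)) : ring_scope.

Section Structures.
Variable k : fieldType.

Definition is_algebra (V : lmodType k) (mul : V -> V -> V) (one : V) : Prop :=
  [/\ bilinear_for *:%R *:%R mul, associative mul,
      left_id one mul & right_id one mul].

Definition is_coalgebra (V : lmodType k) (Delta : V -> V ⨂ V) (eps : V -> k)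
    : Prop :=
  [/\ linear Delta, scalar eps,
      forall v, \tsum[v1, v2 <- Delta v] Delta v1 ⊗ v2 =
        \tsum[v1, v2 <- Delta v] \tsum[v21, v22 <- Delta v2] v1 ⊗ v21 ⊗ v22,
      forall v, \tsum[v1, v2 <- Delta v] eps v1 *: v2 = v
    & forall v, \tsum[v1, v2 <- Delta v] eps v2 *: v1 = v].

Definition tmul (V W : lmodType k) (mV : V -> V -> V) (mW : W -> W -> W)
    (s t : V ⨂ W) : V ⨂ W :=
  \tsum[v, w <- s] \tsum[v', w' <- t] mV v v' ⊗ mW w w'.

Definition is_bialgebra (V : lmodType k) (mul : V -> V -> V) (one : V)
    (Delta : V -> V ⨂ V) (eps : V -> k) : Prop :=
  [/\ is_algebra mul one, is_coalgebra Delta eps,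
      (forall x y, Delta (mul x y) = tmul mul mul (Delta x) (Delta y))
        /\ Delta one = one ⊗ one
    & (forall x y, eps (mul x y) = eps x * eps y) /\ eps one = 1].

Definition is_quasitriangular (V : lmodType k) (mul : V -> V -> V) (one : V)
    (Delta : V -> V ⨂ V) (eps : V -> k) (R : V ⨂ V) : Prop :=
  let mul3 := tmul (tmul mul mul) mul in
  let R12 := \tsum[r1, r2 <- R] r1 ⊗ r2 ⊗ one in
  let R13 := \tsum[r1, r2 <- R] r1 ⊗ one ⊗ r2 in
  let R23 := \tsum[r1, r2 <- R] one ⊗ r1 ⊗ r2 in
  let Delta_cop h := \tsum[h1, h2 <- Delta h] h2 ⊗ h1 in
  [/\ \tsum[r1, r2 <- R] eps r1 *: r2 = one
        /\ \tsum[r1, r2 <- R] eps r2 *: r1 = one,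
      \tsum[r1, r2 <- R] Delta r1 ⊗ r2 = mul3 R13 R23,
      \tsum[r1, r2 <- R] \tsum[s1, s2 <- Delta r2] r1 ⊗ s1 ⊗ s2 = mul3 R13 R12
    & forall h, tmul mul mul R (Delta h) = tmul mul mul (Delta_cop h) R].

Definition normalized (V W : lmodType k) (eV : V -> k) (eW : W -> k)
    (oneV : V) (oneW : W) (t : V ⨂ W) : Prop :=
  \tsum[v, w <- t] eV v *: w = oneW /\ \tsum[v, w <- t] eW w *: v = oneV.

End Structures.

Section Smash.
Variables (k : fieldType) (A B : algType k).
Variables (DeltaA : {linear A -> A ⨂ A}) (epsA : {scalar A}).
Variables (DeltaB : {linear B -> B ⨂ B}) (epsB : {scalar B}).
Variables (sigma : {linear B ⨂ A -> A ⨂ B}) (tau : {linear A ⨂ B -> B ⨂ A}).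

Definition smash_mul (x y : A ⨂ B) : A ⨂ B :=
  \tsum[a, b <- x] \tsum[a', b' <- y]
    \tsum[a's, bs <- sigma (b ⊗ a')] (a * a's) ⊗ (bs * b').

Definition smash_one : A ⨂ B := 1 ⊗ 1.

Definition smash_comul (x : A ⨂ B) : (A ⨂ B) ⨂ (A ⨂ B) :=
  \tsum[a, b <- x] \tsum[a1, a2 <- DeltaA a] \tsum[b1, b2 <- DeltaB b]
    \tsum[b1t, a2t <- tau (a2 ⊗ b1)] (a1 ⊗ b1t) ⊗ (a2t ⊗ b2).

Definition smash_counit (x : A ⨂ B) : k := \tsum[a, b <- x] (epsA a * epsB b).

Record smash_biproduct_bialgebra : Prop := SmashBiproductBialgebra {
  smash_coalgA : is_coalgebra DeltaA epsA;
  smash_coalgB : is_coalgebra DeltaB epsB;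
  smash_product : is_algebra smash_mul smash_one;
  smash_coproduct : is_coalgebra smash_comul smash_counit;
  smash_bialgebra :
    is_bialgebra smash_mul smash_one smash_comul smash_counit;
  smash_counitalA : monoid_morphism (epsA : A -> k);
  smash_counitalB : monoid_morphism (epsB : B -> k);
  smash_unitalA : DeltaA 1 = 1 ⊗ 1 /\ epsA 1 = 1;
  smash_unitalB : DeltaB 1 = 1 ⊗ 1 /\ epsB 1 = 1
}.

Definition right_conormal : Prop :=
  forall (a : A) (b : B),
    \tsum[as_, bs <- sigma (b ⊗ a)] epsA as_ *: bs = epsA a *: b.

End Smash.

(* Main.v *)
Require Import Defs.
From mathcomp Require Import all_boot all_order all_algebra.
Set Implicit Arguments.
Unset Strict Implicit.
Unset Printing Implicit Defensive.
Import GRing.Theory.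
Local Open Scope ring_scope.

(** Write H for the biproduct on A ⨂ B, and pA = id ⊗ epsB : H -> A and
    pB = epsA ⊗ id : H -> B for its projections.  Right conormality of sigma
    makes pB a map of bialgebras, so that B is a bialgebra, while pA presents
    A as the quotient of H by the left ideal generated by ker epsB.  Thus A is
    a left H-module coalgebra with pA (x y) = x ▹ pA y, the product of H is
    x (a ⊗ b) = Σ (x1 ▹ a) ⊗ pB x2 b, the map tau is (pB ⊗ pA) Δ, and every h
    in H is Σ pA h1 ⊗ pB h2.  The last formula is what turns identities
    between projections into identities in H.

    Suppose for a moment that R is a quasitriangular structure of H, and put
    W, X, Y, Z for its images under pB ⊗ pB, pA ⊗ pB, pB ⊗ pA, pA ⊗ pA.
    Expanding one leg by h = Σ pA h1 ⊗ pB h2 and using the formulas for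
    (Δ ⊗ id) R and (id ⊗ Δ) R expresses the partial projections of R by W, X,
    Y, Z:
      (id ⊗ pB) R = RHB = Σ (X1 ⊗ W1) ⊗ X2 W2,
      (pA ⊗ id) R = RAH = Σ (s1 ▹ Z1) ⊗ (Z2 ⊗ s2),
      (pB ⊗ id) R = RBH = Σ pB s1 Y1 ⊗ (Y2 ⊗ s2),
      (id ⊗ pA) R = RHA = Σ (p1 ⊗ Y1) ⊗ (p2 ▹ Y2),
    where s runs over RHB and p over RAH, and R itself is
    RHH = Σ s1 t1 ⊗ (t2 ⊗ s2) with t running over RHA.  The proof takes these
    formulas as definitions.  The nineteen hypotheses are then the images of
    the axioms of a quasitriangular structure under the projections to A and B
    of all their legs, and the axioms are recovered by lifting one leg at a
    time from A and B to H.

    Three of the elements above, and RHH among them, arise from the same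
    operation: for a left H-module coalgebra N and G in N ⨂ A, form
    lift G = Σ s1 g1 ⊗ (g2 ⊗ s2) in N ⨂ H.  It turns a formula for the
    coproduct of the first leg of G into one for lift G (lift_comul1), and a
    commutation rule of G with coproducts into one for lift G (lift_braid).
    It is applied to (A, Z), to (B, Y) and to (H, RHA).

    For (Δ ⊗ id) RHH: the coproduct of RHB comes from comul_two_factors, those
    of RAH and RBH are lifts, they give the coproduct of RHA (RHA_comul1), and
    lifting once more gives RHH_comul1.  For (id ⊗ Δ) RHH (RHH_comul2) the
    factorization RHH = RAH_13 RBH_23 (tsum_RHH_AB) reduces the claim to the
    coproducts of the second legs of RAH and RBH.  For the relation between Δ
    and its opposite (braid_HH), the four versions with both legs projected
    are established first, for all h in H, and are lifted along RHB, RAH, RHA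
    and RHH.  Finally tsum_RHH_expanded identifies RHH with alpha. *)

(** * Multilinear maps and sums over tensors *)

Section Multilinear.
Variable k : fieldType.
Implicit Types V W U X : lmodType k.

(** Linearity as a bare predicate, so that it applies to a function written
    as an explicit nested sum without bundling it first. *)
Definition lin V U (f : V -> U) : Prop :=
  forall c x y, f (c *: x + y) = c *: f x + f y.

Definition bilin V W U (F : V -> W -> U) : Prop :=
  (forall y, lin (fun x => F x y)) /\ (forall x, lin (F x)).

Definition trilin V1 V2 V3 U (F : V1 -> V2 -> V3 -> U) : Prop :=
  [/\ forall y z, lin (fun x => F x y z), forall x z, lin (fun y => F x y z)
    & forall x y, lin (F x y)].

Lemma lin_id V : lin (fun x : V => x). Proof. by []. Qed.

Lemma lin_comp V W U (g : W -> U) (f : V -> W) :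
  lin g -> lin f -> lin (fun x => g (f x)).
Proof. by move=> Hg Hf c x y; rewrite Hf Hg. Qed.

Lemma linD V U (f : V -> U) : lin f -> {morph f : x y / x + y}.
Proof. by move=> Hf x y; have := Hf 1 x y; rewrite !scale1r. Qed.

Lemma lin0 V U (f : V -> U) : lin f -> f 0 = 0.
Proof. by move=> Hf; apply: (addrI (f 0)); rewrite -(linD Hf) !addr0. Qed.

Lemma linZ V U (f : V -> U) c x : lin f -> f (c *: x) = c *: f x.
Proof. by move=> Hf; have := Hf c x 0; rewrite (lin0 Hf) !addr0. Qed.

Lemma lin_sum V U (f : V -> U) I (r : seq I) (E : I -> V) :
  lin f -> f (\sum_(i <- r) E i) = \sum_(i <- r) f (E i).
Proof. by move=> Hf; apply: (big_morph f (linD Hf) (lin0 Hf)). Qed.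

Lemma bilin1 V W U (F : V -> W -> U) y : bilin F -> lin (fun x => F x y).
Proof. by case. Qed.
Lemma bilin2 V W U (F : V -> W -> U) x : bilin F -> lin (F x).
Proof. by case. Qed.
Lemma trilin1 V1 V2 V3 U (F : V1 -> V2 -> V3 -> U) y z :
  trilin F -> lin (fun x => F x y z).
Proof. by case. Qed.
Lemma trilin2 V1 V2 V3 U (F : V1 -> V2 -> V3 -> U) x z :
  trilin F -> lin (fun y => F x y z).
Proof. by case. Qed.
Lemma trilin3 V1 V2 V3 U (F : V1 -> V2 -> V3 -> U) x y :
  trilin F -> lin (F x y).
Proof. by case. Qed.

Lemma bilinE V W U (F : V -> W -> U) : bilin F -> bilinear_for *:%R *:%R F.
Proof. by case=> H1 H2; split=> [y|x] c u v; [apply: H1 | apply: H2]. Qed.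

Lemma lin_bundle V U (f : {linear V -> U}) : lin f.
Proof. by move=> c x y; rewrite linearP. Qed.

Lemma lin_scale V c : lin ( *:%R c : V -> V).
Proof. by move=> d x y; rewrite scalerDr !scalerA mulrC. Qed.

Lemma lin_scalar V U (f : {scalar V}) (v : U) : lin (fun x => f x *: v).
Proof. by move=> c x y; rewrite linearP /= scalerDl scalerA. Qed.

Lemma lin_mull (A : algType k) (a : A) : lin (fun x : A => x * a).
Proof. by move=> c x y; rewrite mulrDl scalerAl. Qed.
Lemma lin_mulr (A : algType k) (a : A) : lin (fun x : A => a * x).
Proof. by move=> c x y; rewrite mulrDr scalerAr. Qed.

Lemma lin_tpure1 V W (w : W) : lin (fun v : V => v ⊗ w).
Proof. by move=> c x y; have [H _] := tpure_bilinear V W; apply: H. Qed.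
Lemma lin_tpure2 V W (v : V) : lin (fun w : W => v ⊗ w).
Proof. by move=> c x y; have [_ H] := tpure_bilinear V W; apply: H. Qed.

Lemma lin_tsum V W U (F : V -> W -> U) : bilin F -> lin (fun t => tsum t F).
Proof. by move=> HF c s t; rewrite tsum_linear //; apply: bilinE. Qed.

(** The body of a sum may depend linearly on an outer variable even when the
    tensor summed over does not: the other half of multilinearity of a nested
    sum, besides lin_tsum. *)
Lemma lin_tsum_body V W X U (t : V ⨂ W) (F : X -> V -> W -> U) :
  (forall v w, lin (fun x => F x v w)) -> lin (fun x => tsum t (F x)).
Proof.
move=> HF c x y; rewrite /tsum scaler_sumr -big_split /=.
by apply: eq_bigr => p _; apply: HF.
Qed.

Lemma tsumE V W U (F : V -> W -> U) v w : bilin F -> tsum (v ⊗ w) F = F v w.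
Proof. by move=> /bilinE; apply: tsum_tpure. Qed.

Lemma eq_tsum V W (U : nmodType) (t : V ⨂ W) (F G : V -> W -> U) :
  (forall v w, F v w = G v w) -> tsum t F = tsum t G.
Proof. by move=> H; apply: eq_bigr => p _; apply: H. Qed.

(** Both sides are finite sums over a representative of t; only F has to respect
    the relations of the tensor product. *)
Lemma tsum_tsum V W V' W' U (t : V' ⨂ W') (G : V' -> W' -> V ⨂ W)
    (F : V -> W -> U) :
  bilin F -> tsum (tsum t G) F = \tsum[x, y <- t] tsum (G x y) F.
Proof.
by move=> HF; apply: (lin_sum (repr t) (fun p => G p.1 p.2) (lin_tsum HF)).
Qed.

Lemma lin_tsumE V W X U (f : X -> U) (t : V ⨂ W) (G : V -> W -> X) :
  lin f -> f (tsum t G) = \tsum[x, y <- t] f (G x y).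
Proof. by move=> Hf; apply: (lin_sum (repr t) (fun p => G p.1 p.2) Hf). Qed.

Lemma tsumZ V W U c (t : V ⨂ W) (G : V -> W -> U) :
  c *: tsum t G = \tsum[x, y <- t] c *: G x y.
Proof. exact: lin_tsumE (@lin_scale _ c). Qed.

Lemma tsum_exch V W V' W' (U : nmodType) (s : V ⨂ W) (t : V' ⨂ W')
    (F : V -> W -> V' -> W' -> U) :
  \tsum[a, b <- s] \tsum[c, d <- t] F a b c d =
  \tsum[c, d <- t] \tsum[a, b <- s] F a b c d.
Proof. exact: exchange_big. Qed.

(** Pure tensors span. *)
Lemma tens_lin_ext V W U (f g : V ⨂ W -> U) :
  lin f -> lin g -> (forall v w, f (v ⊗ w) = g (v ⊗ w)) -> f =1 g.
Proof.
move=> Hf Hg H t; rewrite -[t]tsum_id !(lin_tsumE _ _ Hf, lin_tsumE _ _ Hg).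
exact: eq_tsum.
Qed.

(** An identity in a triple tensor product is used by evaluating both sides
    against an arbitrary trilinear K; this is that evaluation. *)
Definition tsum3 V1 V2 V3 U (K : V1 -> V2 -> V3 -> U) (t : V1 ⨂ V2 ⨂ V3) : U :=
  \tsum[xy, z <- t] \tsum[x, y <- xy] K x y z.

End Multilinear.

Create HintDb multilin.
#[local] Hint Extern 1 (lin _) => exact: lin_bundle : multilin.
#[local] Hint Extern 1 (lin _) => exact: lin_scale : multilin.
#[local] Hint Extern 1 (lin _) => exact: lin_scalar : multilin.
#[local] Hint Extern 1 (lin _) => exact: lin_tpure1 : multilin.
#[local] Hint Extern 1 (lin _) => exact: lin_tpure2 : multilin.
#[local] Hint Extern 1 (lin _) => exact: lin_mull : multilin.
#[local] Hint Extern 1 (lin _) => exact: lin_mulr : multilin.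
#[local] Hint Extern 1 (lin _) => assumption : multilin.
#[local] Hint Extern 1 (lin _) =>
  match goal with
  | H : bilin _ |- _ => first [exact (bilin1 _ H) | exact (bilin2 _ H)]
  | H : trilin _ |- _ =>
      first [exact (trilin1 _ _ H) | exact (trilin2 _ _ H)
            | exact (trilin3 _ _ H)]
  end : multilin.

Ltac lin_base := solve [auto 1 with multilin nocore].

(** Decides linearity of an explicit expression by descending along its one
    occurrence of the variable; lin_base closes the elementary steps with the
    hints of the database multilin. *)
Ltac multilin :=
  cbv beta;
  lazymatch goal with
  | |- bilin _ => split; intros; multilin
  | |- trilin _ => split; intros; multilin
  | |- lin (fun x => x) => exact (@lin_id _ _)
  | |- lin (fun x => tsum (@?t x) (@?F x)) =>
      lazymatch t with
      | fun _ => ?t0 =>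
          refine (@lin_tsum_body _ _ _ _ _ t0 F _); intros; multilin
      | _ => lazymatch F with fun _ => ?F0 =>
          refine (@lin_comp _ _ _ _ (fun y => tsum y F0) t _ _);
          [refine (@lin_tsum _ _ _ _ F0 _); multilin | multilin] end
      end
  | |- lin (fun x => @?f x) => multilin_app
  | |- lin _ => lin_base
  end
with multilin_app :=
  match goal with
  | |- lin (fun x => ?e (@?f x) *: ?v) =>
      refine (@lin_comp _ _ _ _ (fun y => e y *: v) f _ _);
        [lin_base | multilin]
  | |- lin (fun x => ?g (@?f x)) =>
      refine (@lin_comp _ _ _ _ g f _ _); [lin_base | multilin]
  | |- lin (fun x => ?g (@?f x) ?a) =>
      refine (@lin_comp _ _ _ _ (fun y => g y a) f _ _);
        [lin_base | multilin]
  | |- lin (fun x => ?g (@?f x) ?a ?b) =>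
      refine (@lin_comp _ _ _ _ (fun y => g y a b) f _ _);
        [lin_base | multilin]
  end.

#[local] Hint Extern 0 (lin _) => multilin : core.
#[local] Hint Extern 0 (bilin _) => multilin : core.
#[local] Hint Extern 0 (trilin _) => multilin : core.

Section ThreeLegs.
Variables (k : fieldType) (V1 V2 V3 U : lmodType k).

Lemma tsum3E (K : V1 -> V2 -> V3 -> U) x y z :
  trilin K -> tsum3 K (x ⊗ y ⊗ z) = K x y z.
Proof. by move=> HK; rewrite /tsum3 tsumE ?tsumE. Qed.

Lemma lin_tsum3 (K : V1 -> V2 -> V3 -> U) : trilin K -> lin (tsum3 K).
Proof. by move=> HK; rewrite /tsum3; multilin. Qed.
End ThreeLegs.

(** Moves a linear map, with linearity proof Hf, through all the sums of the
    left-hand side that match sums of the right-hand side; leaf then treats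
    the summands. *)
Ltac push_tsum Hf leaf :=
  first [ rewrite (lin_tsumE _ _ Hf); apply: eq_tsum => ? ?; push_tsum Hf leaf
        | leaf ].

Section Coalgebra.
Variables (k : fieldType) (V : lmodType k) (D : V -> V ⨂ V) (e : V -> k).
Hypothesis coalg : is_coalgebra D e.

(** The coalgebra axioms in evaluated form. *)
Lemma counitl (U : lmodType k) (F : V -> U) v :
  lin F -> \tsum[v1, v2 <- D v] e v1 *: F v2 = F v.
Proof.
case: coalg => _ _ _ Hl _ HF; rewrite -[in RHS](Hl v) (lin_tsumE _ _ HF).
by apply: eq_tsum => x y; rewrite (linZ _ _ HF).
Qed.

Lemma counitr (U : lmodType k) (F : V -> U) v :
  lin F -> \tsum[v1, v2 <- D v] e v2 *: F v1 = F v.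
Proof.
case: coalg => _ _ _ _ Hr HF; rewrite -[in RHS](Hr v) (lin_tsumE _ _ HF).
by apply: eq_tsum => x y; rewrite (linZ _ _ HF).
Qed.

Lemma coassoc (U : lmodType k) (K : V -> V -> V -> U) v : trilin K ->
  \tsum[v1, v2 <- D v] \tsum[v11, v12 <- D v1] K v11 v12 v2 =
  \tsum[v1, v2 <- D v] \tsum[v21, v22 <- D v2] K v1 v21 v22.
Proof.
case: coalg => _ _ HA _ _ HK; have := congr1 (tsum3 K) (HA v).
rewrite (lin_tsumE _ _ (lin_tsum3 HK)) => E.
transitivity (\tsum[x, y <- D v] tsum3 K (D x ⊗ y)).
  by apply: eq_tsum => x y; rewrite /tsum3 tsumE.
rewrite E; push_tsum (lin_tsum3 HK) ltac:(exact: tsum3E).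
Qed.
End Coalgebra.

(** * Projections, action and coaction of a smash biproduct *)

Section Smash.
Variables (k : fieldType) (A B : algType k).
Variables (DeltaA : {linear A -> A ⨂ A}) (epsA : {scalar A}).
Variables (DeltaB : {linear B -> B ⨂ B}) (epsB : {scalar B}).
Variables (sigma : {linear B ⨂ A -> A ⨂ B}) (tau : {linear A ⨂ B -> B ⨂ A}).

Local Notation H := (A ⨂ B).
Local Notation Delta := (smash_comul DeltaA DeltaB tau).
Local Notation eps := (smash_counit epsA epsB).
Local Notation "x ∙ y" := (smash_mul sigma x y)
  (at level 40, left associativity).

Definition pA (h : H) : A := \tsum[a, b <- h] epsB b *: a.
Definition pB (h : H) : B := \tsum[a, b <- h] epsA a *: b.
(** The action of H on A = H / H (ker epsB); pAM below says that pA is the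
    quotient map of H-modules. *)
Definition act (h : H) (a : A) : A := pA (h ∙ (a ⊗ 1)).
Local Notation "h ▹ a" := (act h a) (at level 38, right associativity).

Lemma lin_pA : lin pA. Proof. by rewrite /pA; multilin. Qed.
Lemma lin_pB : lin pB. Proof. by rewrite /pB; multilin. Qed.
Lemma lin_smash_mull y : lin (fun x => x ∙ y).
Proof. by rewrite /smash_mul; multilin. Qed.
Lemma lin_smash_mulr x : lin (smash_mul sigma x).
Proof. by rewrite /smash_mul; multilin. Qed.
Lemma lin_comul : lin Delta.
Proof. by rewrite /smash_comul; multilin. Qed.
Lemma lin_act1 a : lin (fun h => h ▹ a).
Proof. exact: lin_comp lin_pA (lin_smash_mull _). Qed.
Lemma lin_act2 h : lin (act h).
Proof.
exact: (lin_comp (lin_comp lin_pA (lin_smash_mulr h)) (lin_tpure1 (1 : B))).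
Qed.

#[local] Hint Extern 1 (lin _) => exact: lin_pA : multilin.
#[local] Hint Extern 1 (lin _) => exact: lin_pB : multilin.
#[local] Hint Extern 1 (lin _) => exact: lin_smash_mull : multilin.
#[local] Hint Extern 1 (lin _) => exact: lin_smash_mulr : multilin.
#[local] Hint Extern 1 (lin _) => exact: lin_comul : multilin.
#[local] Hint Extern 1 (lin _) => exact: lin_act1 : multilin.
#[local] Hint Extern 1 (lin _) => exact: lin_act2 : multilin.

Lemma pAE a b : pA (a ⊗ b) = epsB b *: a. Proof. by rewrite /pA tsumE. Qed.
Lemma pBE a b : pB (a ⊗ b) = epsA a *: b. Proof. by rewrite /pB tsumE. Qed.

Lemma bilin_eps : bilin (fun a b => epsA a * epsB b : k^o).
Proof.
split=> [b|a] c x y; rewrite linearP /=; first by rewrite mulrDl -mulrA.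
by rewrite mulrDr mulrCA.
Qed.

(** The counit takes values in k; scaling a fixed vector by it turns it into a
    map between vector spaces, which is also the form in which it occurs. *)
Lemma lin_eps (U : lmodType k) (u : U) : lin (fun h => eps h *: u).
Proof.
move=> c x y; rewrite scalerA -scalerDl; congr (_ *: u); move: c x y.
change (lin (smash_counit epsA epsB : H -> k^o)); rewrite /smash_counit.
exact: lin_tsum bilin_eps.
Qed.
#[local] Hint Extern 1 (lin _) => exact: lin_eps : multilin.

Lemma epsE a b : eps (a ⊗ b) = epsA a * epsB b.
Proof.
change (smash_counit epsA epsB (a ⊗ b) = (epsA a * epsB b : k^o)).
exact: tsumE bilin_eps.
Qed.

Lemma smash_mulE a b a' b' : (a ⊗ b) ∙ (a' ⊗ b') =
  \tsum[as_, bs <- sigma (b ⊗ a')] (a * as_) ⊗ (bs * b').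
Proof. by rewrite /smash_mul tsumE ?tsumE. Qed.

Lemma comulE (U : lmodType k) (K : H -> H -> U) a b : bilin K ->
  tsum (Delta (a ⊗ b)) K =
  \tsum[a1, a2 <- DeltaA a] \tsum[b1, b2 <- DeltaB b]
    \tsum[b1t, a2t <- tau (a2 ⊗ b1)] K (a1 ⊗ b1t) (a2t ⊗ b2).
Proof.
move=> HK; rewrite /smash_comul tsumE // tsum_tsum //.
apply: eq_tsum => a1 a2; rewrite tsum_tsum //; apply: eq_tsum => b1 b2.
by rewrite tsum_tsum //; apply: eq_tsum => b1t a2t; rewrite tsumE.
Qed.

Hypothesis smashH :
  smash_biproduct_bialgebra DeltaA epsA DeltaB epsB sigma tau.
Hypothesis conormal : right_conormal epsA sigma.

Let bialgH := smash_bialgebra smashH.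

Lemma smash_mulA x y z : x ∙ (y ∙ z) = x ∙ y ∙ z.
Proof. by case: (smash_product smashH) => _ + _ _; apply. Qed.
Lemma smash_mul1l x : (1 ⊗ 1) ∙ x = x.
Proof. by case: (smash_product smashH) => _ _ + _; apply. Qed.
Lemma smash_mul1r x : x ∙ (1 ⊗ 1) = x.
Proof. by case: (smash_product smashH) => _ _ _; apply. Qed.

Lemma epsA1 : epsA 1 = 1. Proof. by case: (smash_counitalA smashH). Qed.
Lemma epsB1 : epsB 1 = 1. Proof. by case: (smash_counitalB smashH). Qed.
Lemma epsAM a a' : epsA (a * a') = epsA a * epsA a'.
Proof. by case: (smash_counitalA smashH) => _ ->. Qed.
Lemma epsBM b b' : epsB (b * b') = epsB b * epsB b'.
Proof. by case: (smash_counitalB smashH) => _ ->. Qed.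

Let coalgA := smash_coalgA smashH.
Let coalgB := smash_coalgB smashH.
Let coalgH := smash_coproduct smashH.

(** This is 1 ⊗ b times the unit. *)
Lemma sigmaB1 b : sigma (b ⊗ 1) = 1 ⊗ b.
Proof.
rewrite -[RHS]smash_mul1r smash_mulE -[LHS]tsum_id.
by apply: eq_tsum => x y; rewrite mul1r mulr1.
Qed.

Section Projections.
Variable U : lmodType k.

(** Both counit conditions on tau come for free from the counit of H: apply it
    to the first leg of Δ (a ⊗ b) and project the second leg to A. *)
Lemma tau_epsB (F : A -> U) a b : lin F ->
  \tsum[bt, at_ <- tau (a ⊗ b)] epsB bt *: F at_ = epsB b *: F a.
Proof.
move=> HF.
have E := counitl coalgH (F := fun h => F (pA h)) (a ⊗ b) ltac:(multilin).
rewrite pAE (linZ _ _ HF) comulE // in E; rewrite -E.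
rewrite -(counitl coalgA (F := fun a =>
  \tsum[bt, at_ <- tau (a ⊗ b)] epsB bt *: F at_) a) //.
apply: eq_tsum => a1 a2.
rewrite -(counitr coalgB (F := fun b =>
  \tsum[bt, at_ <- tau (a2 ⊗ b)] epsB bt *: F at_) b) // tsumZ.
apply: eq_tsum => b1 b2; rewrite !tsumZ.
apply: eq_tsum => b1t a2t.
rewrite epsE pAE (linZ _ _ HF) !scalerA; congr (_ *: _).
by rewrite mulrAC -mulrA.
Qed.

(** The mirror image: counit on the second leg, first leg projected to B. *)
Lemma tau_epsA (F : B -> U) a b : lin F ->
  \tsum[bt, at_ <- tau (a ⊗ b)] epsA at_ *: F bt = epsA a *: F b.
Proof.
move=> HF.
have E := counitr coalgH (F := fun h => F (pB h)) (a ⊗ b) ltac:(multilin).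
rewrite pBE (linZ _ _ HF) comulE // in E; rewrite -E.
rewrite -(counitl coalgA (F := fun a =>
  \tsum[bt, at_ <- tau (a ⊗ b)] epsA at_ *: F bt) a) //.
apply: eq_tsum => a1 a2.
rewrite -(counitr coalgB (F := fun b =>
  \tsum[bt, at_ <- tau (a2 ⊗ b)] epsA at_ *: F bt) b) // tsumZ.
apply: eq_tsum => b1 b2; rewrite !tsumZ.
apply: eq_tsum => b1t a2t.
rewrite epsE pBE (linZ _ _ HF) !scalerA; congr (_ *: _).
by rewrite mulrC -mulrA; congr (_ * _); exact: mulrC.
Qed.

(** pB applies epsA to the leg of tau in A, where tau collapses; so the right
    B-coaction on H only involves the B-factor. *)
Lemma comul_pB_pure (K : H -> B -> U) a b : bilin K ->
  \tsum[h1, h2 <- Delta (a ⊗ b)] K h1 (pB h2) =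
  \tsum[b1, b2 <- DeltaB b] K (a ⊗ b1) b2.
Proof.
move=> HK; rewrite comulE // tsum_exch; apply: eq_tsum => b1 b2.
rewrite -[RHS](counitr coalgA (F := fun a => K (a ⊗ b1) b2)) //.
apply: eq_tsum => a1 a2; rewrite -(tau_epsA (F := fun b => K (a1 ⊗ b) b2)) //.
by apply: eq_tsum => b1t a2t; rewrite pBE (linZ _ _ (bilin2 _ HK)).
Qed.

Lemma comul_pA_pure (K : A -> H -> U) a b : bilin K ->
  \tsum[h1, h2 <- Delta (a ⊗ b)] K (pA h1) h2 =
  \tsum[a1, a2 <- DeltaA a] K a1 (a2 ⊗ b).
Proof.
move=> HK; rewrite comulE //; apply: eq_tsum => a1 a2.
rewrite -[RHS](counitl coalgB (F := fun b => K a1 (a2 ⊗ b))) //.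
apply: eq_tsum => b1 b2; rewrite -(tau_epsB (F := fun a => K a1 (a ⊗ b2))) //.
by apply: eq_tsum => b1t a2t; rewrite pAE (linZ _ _ (bilin1 _ HK)).
Qed.

(** An element of H is determined by (pA ⊗ pB) Δ: this is the principle by
    which identities are lifted from A and B to H. *)
Lemma comul_pApB (K : A -> B -> U) h : bilin K ->
  \tsum[h1, h2 <- Delta h] K (pA h1) (pB h2) = tsum h K.
Proof.
move=> HK; move: h; apply: tens_lin_ext => // a b; rewrite tsumE //.
rewrite (comul_pB_pure (K := fun h => K (pA h))) //.
rewrite -(counitl coalgB (F := K a)) //.
by apply: eq_tsum => b1 b2; rewrite pAE (linZ _ _ (bilin1 _ HK)).
Qed.

(** The map tau is an intrinsic part of the coproduct of H, so statements
    about tau can be obtained from the bialgebra axioms of H. *)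
Lemma comul_pBpA (K : B -> A -> U) h : bilin K ->
  \tsum[h1, h2 <- Delta h] K (pB h1) (pA h2) = tsum (tau h) K.
Proof.
move=> HK; move: h; apply: tens_lin_ext => // a b; rewrite comulE //.
rewrite -(counitl coalgA (F := fun a => tsum (tau (a ⊗ b)) K)) //.
apply: eq_tsum => a1 a2.
rewrite -(counitr coalgB (F := fun b => tsum (tau (a2 ⊗ b)) K)) //.
rewrite tsumZ; apply: eq_tsum => b1 b2.
rewrite !tsumZ; apply: eq_tsum => b1t a2t.
by rewrite pAE pBE (linZ _ _ (bilin1 _ HK)) (linZ _ _ (bilin2 _ HK)).
Qed.

Lemma comul_pBpB (K : B -> B -> U) h : bilin K ->
  \tsum[h1, h2 <- Delta h] K (pB h1) (pB h2) = tsum (DeltaB (pB h)) K.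
Proof.
move=> HK; move: h; apply: tens_lin_ext => // a b.
rewrite (comul_pB_pure (K := fun h => K (pB h))) // pBE linearZ /=.
rewrite (linZ _ _ (lin_tsum HK)) tsumZ.
by apply: eq_tsum => b1 b2; rewrite pBE (linZ _ _ (bilin1 _ HK)).
Qed.

Lemma comul_pApA (K : A -> A -> U) h : bilin K ->
  \tsum[h1, h2 <- Delta h] K (pA h1) (pA h2) = tsum (DeltaA (pA h)) K.
Proof.
move=> HK; move: h; apply: tens_lin_ext => // a b.
rewrite (comul_pA_pure (K := fun a h => K a (pA h))) // pAE linearZ /=.
rewrite (linZ _ _ (lin_tsum HK)) tsumZ.
by apply: eq_tsum => b1 b2; rewrite pAE (linZ _ _ (bilin2 _ HK)).
Qed.

Lemma comulM (K : H -> H -> U) x y : bilin K ->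
  tsum (Delta (x ∙ y)) K =
  \tsum[x1, x2 <- Delta x] \tsum[y1, y2 <- Delta y] K (x1 ∙ y1) (x2 ∙ y2).
Proof.
move=> HK; case: bialgH => _ _ [-> _] _; rewrite /tmul tsum_tsum //.
apply: eq_tsum => x1 x2; rewrite tsum_tsum //.
by apply: eq_tsum => y1 y2; rewrite tsumE.
Qed.
End Projections.

Lemma pA_iA a : pA (a ⊗ 1) = a.
Proof. by rewrite pAE epsB1 scale1r. Qed.
Lemma pB_iB b : pB (1 ⊗ b) = b.
Proof. by rewrite pBE epsA1 scale1r. Qed.

(** This is where right conormality enters. *)
Lemma pBM x y : pB (x ∙ y) = pB x * pB y.
Proof.
move: x; apply: tens_lin_ext => // a b.
move: y; apply: tens_lin_ext => // a' b'.
rewrite smash_mulE (lin_tsumE _ _ lin_pB) !pBE.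
rewrite -scalerAl -scalerAr [RHS]scalerA -scalerA scalerAl -(conormal a' b).
have HF : lin (fun c => epsA a *: (c * b')) by [].
rewrite (lin_tsumE _ _ HF); apply: eq_tsum => as_ bs.
by rewrite pBE epsAM -scalerAl scalerA.
Qed.

(** The factor of y in B only contributes through epsB, which is
    multiplicative. *)
Lemma pAM x y : pA (x ∙ y) = x ▹ pA y.
Proof.
move: x; apply: tens_lin_ext => // a b.
move: y; apply: tens_lin_ext => // a' b'.
rewrite pAE (linZ _ _ (lin_act2 _)) /act !smash_mulE.
rewrite !(lin_tsumE _ _ lin_pA) tsumZ.
by apply: eq_tsum => as_ bs; rewrite !pAE !epsBM epsB1 mulr1 scalerA mulrC.
Qed.

Lemma actM x y a : (x ∙ y) ▹ a = x ▹ y ▹ a.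
Proof. by rewrite [y ▹ a]/act -pAM smash_mulA. Qed.

Lemma act1 a : (1 ⊗ 1) ▹ a = a.
Proof. by rewrite /act smash_mul1l pA_iA. Qed.

Lemma act_pure a b a' : (a ⊗ b) ▹ a' = a * ((1 ⊗ b) ▹ a').
Proof.
rewrite /act !smash_mulE !(lin_tsumE _ _ lin_pA) (lin_tsumE _ _ (lin_mulr a)).
by apply: eq_tsum => as_ bs; rewrite !pAE mul1r scalerAr.
Qed.

Lemma act_iA a a' : (a ⊗ 1) ▹ a' = a * a'.
Proof. by rewrite act_pure act1. Qed.

(** The hypotheses mention sigma almost only with epsB applied to the leg in
    B; that combination is the action of B on A. *)
Lemma sigma_act (U : lmodType k) (F : A -> U) a b : lin F ->
  \tsum[as_, bs <- sigma (b ⊗ a)] epsB bs *: F as_ = F ((1 ⊗ b) ▹ a).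
Proof.
move=> HF; rewrite /act smash_mulE (lin_tsumE _ _ (lin_comp HF lin_pA)).
by apply: eq_tsum => as_ bs; rewrite mul1r mulr1 pAE (linZ _ _ HF).
Qed.

Section ActionComul.
Variable U : lmodType k.

Lemma act_comul (K : A -> A -> U) h a : bilin K ->
  tsum (DeltaA (h ▹ a)) K =
  \tsum[h1, h2 <- Delta h] \tsum[a1, a2 <- DeltaA a] K (h1 ▹ a1) (h2 ▹ a2).
Proof.
move=> HK; rewrite -comul_pApA // (comulM (K := fun x y => K (pA x) (pA y))) //.
apply: eq_tsum => h1 h2; rewrite -[a in RHS]pA_iA -comul_pApA //.
by apply: eq_tsum => x1 x2; rewrite !pAM.
Qed.

(** B inherits the bialgebra axiom from H through the surjection pB. *)
Lemma comulB_M (K : B -> B -> U) b b' : bilin K ->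
  tsum (DeltaB (b * b')) K =
  \tsum[b1, b2 <- DeltaB b] \tsum[c1, c2 <- DeltaB b'] K (b1 * c1) (b2 * c2).
Proof.
move=> HK; rewrite -[b in LHS]pB_iB -[b' in LHS]pB_iB -pBM -comul_pBpB //.
rewrite (comulM (K := fun x y => K (pB x) (pB y))) //.
rewrite -[b in RHS]pB_iB -comul_pBpB //; apply: eq_tsum => h1 h2.
rewrite -[b' in RHS]pB_iB -comul_pBpB //; apply: eq_tsum => x1 x2.
by rewrite !pBM.
Qed.

(** Since tau = (pB ⊗ pA) Δ, multiplicativity of Δ gives a product rule. *)
Lemma tauM (K : B -> A -> U) x y : bilin K ->
  tsum (tau (x ∙ y)) K =
  \tsum[x1, x2 <- Delta x] \tsum[bt, at_ <- tau y] K (pB x1 * bt) (x2 ▹ at_).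
Proof.
move=> HK; rewrite -comul_pBpA // (comulM (K := fun x y => K (pB x) (pA y))) //.
apply: eq_tsum => x1 x2; rewrite -comul_pBpA //.
by apply: eq_tsum => y1 y2; rewrite pAM pBM.
Qed.

(** Multiplicativity of Δ, read through (pA ⊗ pB) Δ = id. *)
Lemma pApB_mul (K : A -> B -> U) x a b : bilin K ->
  tsum (x ∙ (a ⊗ b)) K =
  \tsum[x1, x2 <- Delta x] K (x1 ▹ a) (pB x2 * b).
Proof.
move=> HK; rewrite -comul_pApB // (comulM (K := fun x y => K (pA x) (pB y))) //.
apply: eq_tsum => x1 x2.
rewrite -[RHS](tsumE (F := fun a b => K (x1 ▹ a) (pB x2 * b))) //.
rewrite -comul_pApB //.
by apply: eq_tsum => y1 y2; rewrite pAM pBM.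
Qed.

End ActionComul.

(** Consequently H is an ordinary smash product of A with the bialgebra B, and
    sigma is determined by the action. *)
Lemma mul_pure x a b :
  x ∙ (a ⊗ b) = \tsum[x1, x2 <- Delta x] (x1 ▹ a) ⊗ (pB x2 * b).
Proof. by rewrite -[LHS]tsum_id pApB_mul. Qed.

Lemma mul_pure_pure a b a' b' : (a ⊗ b) ∙ (a' ⊗ b') =
  \tsum[b1, b2 <- DeltaB b] (a * ((1 ⊗ b1) ▹ a')) ⊗ (b2 * b').
Proof.
rewrite mul_pure (comul_pB_pure (K := fun h b => (h ▹ a') ⊗ (b * b'))) //.
by apply: eq_tsum => b1 b2; rewrite act_pure.
Qed.

(** For h in B this says that A is a B-module algebra. *)
Lemma act_mulA h a a' :
  h ▹ (a * a') = \tsum[h1, h2 <- Delta h] (h1 ▹ a) * ((1 ⊗ pB h2) ▹ a').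
Proof.
rewrite -act_iA -actM mul_pure (lin_tsumE _ _ (lin_act1 a')).
by apply: eq_tsum => h1 h2; rewrite mulr1 act_pure.
Qed.

Lemma iAiB a b : (a ⊗ 1) ∙ (1 ⊗ b) = a ⊗ b.
Proof. by rewrite smash_mulE sigmaB1 tsumE // mulr1 mul1r. Qed.

Section Factors.
Variable U : lmodType k.

Lemma comul_iA (K : H -> H -> U) a : bilin K ->
  tsum (Delta (a ⊗ 1)) K =
  \tsum[a1, a2 <- DeltaA a] \tsum[i, at_ <- tau (a2 ⊗ 1)]
    K (a1 ⊗ i) (at_ ⊗ 1).
Proof.
move=> HK; rewrite comulE //; apply: eq_tsum => a1 a2.
by case: (smash_unitalB smashH) => -> _; rewrite tsumE.
Qed.

Lemma comul_iB (K : H -> H -> U) b : bilin K ->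
  tsum (Delta (1 ⊗ b)) K =
  \tsum[b1, b2 <- DeltaB b] \tsum[bt, j <- tau (1 ⊗ b1)]
    K (1 ⊗ bt) (j ⊗ b2).
Proof.
move=> HK; rewrite comulE //.
by case: (smash_unitalA smashH) => -> _; rewrite tsumE.
Qed.

Lemma comul_pB_pure_l (K : B -> H -> U) a b : bilin K ->
  \tsum[h1, h2 <- Delta (a ⊗ b)] K (pB h1) h2 =
  \tsum[b1, b2 <- DeltaB b] \tsum[bt, at_ <- tau (a ⊗ b1)] K bt (at_ ⊗ b2).
Proof.
move=> HK; rewrite comulE // tsum_exch; apply: eq_tsum => b1 b2.
rewrite -(counitl coalgA (F := fun a =>
  \tsum[bt, at_ <- tau (a ⊗ b1)] K bt (at_ ⊗ b2))) //.
apply: eq_tsum => a1 a2; rewrite tsumZ.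
by apply: eq_tsum => bt at_; rewrite pBE (linZ _ _ (bilin1 _ HK)).
Qed.

(** tau is the product of a left coaction of B on A and a right coaction of A
    on B: apply the product rule to a ⊗ b = (a ⊗ 1) (1 ⊗ b). *)
Lemma tau_split (K : B -> A -> U) a b : bilin K ->
  tsum (tau (a ⊗ b)) K =
  \tsum[i, at_ <- tau (a ⊗ 1)] \tsum[bt, j <- tau (1 ⊗ b)]
    K (i * bt) (at_ * j).
Proof.
move=> HK; rewrite -iAiB tauM //.
rewrite (comul_pB_pure_l (K := fun c h =>
  \tsum[bt, at_ <- tau (1 ⊗ b)] K (c * bt) (h ▹ at_))) //.
case: (smash_unitalB smashH) => -> _; rewrite tsumE //.
by do 2!apply: eq_tsum => ? ?; rewrite act_iA.
Qed.
End Factors.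

Lemma sigma_act_mul (U : lmodType k) (F : A -> U) c a b : lin F ->
  \tsum[as_, bs <- sigma (b ⊗ a)] F (epsB bs *: (c * as_)) =
  F (c * ((1 ⊗ b) ▹ a)).
Proof.
move=> HF; rewrite -(sigma_act (F := fun a => F (c * a))) //.
by apply: eq_tsum => as_ bs; rewrite (linZ _ _ HF).
Qed.

Lemma sigmaE (U : lmodType k) (F : A -> B -> U) a b : bilin F ->
  tsum (sigma (b ⊗ a)) F =
  \tsum[b1, b2 <- DeltaB b] F ((1 ⊗ b1) ▹ a) b2.
Proof.
move=> HF.
transitivity (tsum ((1 ⊗ b) ∙ (a ⊗ 1)) F).
  rewrite smash_mulE tsum_tsum //; apply: eq_tsum => as_ bs.
  by rewrite tsumE // mul1r mulr1.
rewrite mul_pure_pure tsum_tsum //; apply: eq_tsum => b1 b2.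
by rewrite tsumE // mul1r mulr1.
Qed.

(** The summands on which the hypotheses apply sigma, in evaluated form. *)
Lemma tsum3_sigma (V1 V2 U : lmodType k) (K : V1 -> V2 -> A -> U)
    u v (c a : A) b : trilin K ->
  tsum3 K (\tsum[as_, bs <- sigma (b ⊗ a)] u ⊗ v ⊗ (epsB bs *: (c * as_))) =
  K u v ((c ⊗ b) ▹ a).
Proof.
move=> HK; rewrite (lin_tsumE _ _ (lin_tsum3 HK)) act_pure.
rewrite -(sigma_act_mul (F := K u v)) //.
by apply: eq_tsum => ? ?; rewrite tsum3E.
Qed.

Lemma tsum3_sigma2 (V2 U : lmodType k) (K : A -> V2 -> A -> U)
    v (c a : A) b (c' a' : A) b' : trilin K ->
  tsum3 K (\tsum[as_, bs <- sigma (b ⊗ a)] \tsum[as', bs' <- sigma (b' ⊗ a')]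
    (epsB bs *: (c * as_)) ⊗ v ⊗ (epsB bs' *: (c' * as'))) =
  K ((c ⊗ b) ▹ a) v ((c' ⊗ b') ▹ a').
Proof.
move=> HK; rewrite (lin_tsumE _ _ (lin_tsum3 HK)) [(c ⊗ b) ▹ a]act_pure.
rewrite -(sigma_act_mul (F := fun a => K a v _)) //.
by apply: eq_tsum => ? ?; rewrite tsum3_sigma.
Qed.

Lemma tsum_sigma (V1 U : lmodType k) (K : V1 -> A -> U) u (c a : A) b :
  bilin K ->
  tsum (\tsum[as_, bs <- sigma (b ⊗ a)] u ⊗ (epsB bs *: (c * as_))) K =
  K u (c * ((1 ⊗ b) ▹ a)).
Proof.
move=> HK; rewrite tsum_tsum // -(sigma_act_mul (F := K u)) //.
by apply: eq_tsum => ? ?; rewrite tsumE.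
Qed.

(** * Products of an element over A and an element over B *)
Section TwoFactors.
Variables (C M : lmodType k) (mC : C -> C -> C) (op : C -> M -> M).
Hypothesis bilin_op : bilin op.
Hypothesis opM : forall c d m, op (mC c d) m = op c (op d m).
Variables (P : A ⨂ C) (Q : B ⨂ C) (Y : B ⨂ M).
Hypothesis comulP : forall (U : lmodType k) (K : A -> A -> C -> U), trilin K ->
  \tsum[p1, p2 <- P] \tsum[a1, a2 <- DeltaA p1] K a1 a2 p2 =
  \tsum[p1, p2 <- P] \tsum[q1, q2 <- P] K p1 q1 (mC p2 q2).
Hypothesis comulY : forall (U : lmodType k) (K : B -> B -> M -> U), trilin K ->
  \tsum[y1, y2 <- Y] \tsum[b1, b2 <- DeltaB y1] K b1 b2 y2 =
  \tsum[q1, q2 <- Q] \tsum[y1, y2 <- Y] K q1 y1 (op q2 y2).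
Hypothesis tauPQ : forall (U : lmodType k) (K : B -> A -> C -> U), trilin K ->
  \tsum[p1, p2 <- P] \tsum[q1, q2 <- Q] \tsum[b, a <- tau (p1 ⊗ q1)]
    K b a (mC p2 q2) =
  \tsum[q1, q2 <- Q] \tsum[p1, p2 <- P] K q1 p1 (mC q2 p2).

(** An element Σ (p1 ⊗ y1) ⊗ p2 y2 is a product of P in A ⨂ C and Y in B ⨂ M.
    The coproduct of H applies tau to the second half of p1 and the first half
    of y1; the hypothesis tauPQ undoes this by exchanging the corresponding
    second legs.  It is used for RHB = X_13 W_23 and for RHA. *)
Lemma comul_two_factors (U : lmodType k) (K : H -> H -> M -> U) : trilin K ->
  \tsum[p1, p2 <- P] \tsum[y1, y2 <- Y] \tsum[h1, h2 <- Delta (p1 ⊗ y1)]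
    K h1 h2 (op p2 y2) =
  \tsum[p1, p2 <- P] \tsum[q1, q2 <- Q] \tsum[r1, r2 <- P]
    \tsum[y1, y2 <- Y]
    K (p1 ⊗ q1) (r1 ⊗ y1) (op p2 (op (mC q2 r2) y2)).
Proof.
move=> HK.
transitivity (\tsum[p1, p2 <- P] \tsum[a1, a2 <- DeltaA p1]
  \tsum[y1, y2 <- Y] \tsum[b1, b2 <- DeltaB y1] \tsum[b, a <- tau (a2 ⊗ b1)]
    K (a1 ⊗ b) (a ⊗ b2) (op p2 y2)).
  apply: eq_tsum => p1 p2; rewrite tsum_exch; apply: eq_tsum => y1 y2.
  by rewrite comulE.
rewrite (comulP (K := fun a1 a2 c => \tsum[y1, y2 <- Y]
  \tsum[b1, b2 <- DeltaB y1] \tsum[b, a <- tau (a2 ⊗ b1)]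
    K (a1 ⊗ b) (a ⊗ b2) (op c y2))) //.
apply: eq_tsum => p1 p2.
transitivity (\tsum[r1, r2 <- P] \tsum[q1, q2 <- Q]
  \tsum[b, a <- tau (r1 ⊗ q1)] \tsum[y1, y2 <- Y]
    K (p1 ⊗ b) (a ⊗ y1) (op p2 (op (mC r2 q2) y2))).
  apply: eq_tsum => r1 r2.
  rewrite (comulY (K := fun b1 b2 m => \tsum[b, a <- tau (r1 ⊗ b1)]
    K (p1 ⊗ b) (a ⊗ b2) (op (mC p2 r2) m))) //.
  apply: eq_tsum => q1 q2; rewrite tsum_exch.
  by do 2!apply: eq_tsum => ? ?; rewrite !opM.
by rewrite (tauPQ (K := fun b a c => \tsum[y1, y2 <- Y]
  K (p1 ⊗ b) (a ⊗ y1) (op p2 (op c y2)))).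
Qed.
End TwoFactors.

(** * Lifting along the corner in H ⨂ B *)

Lemma expand_pApB (U : lmodType k) (K : H -> U) x : lin K ->
  K x = \tsum[x1, x2 <- Delta x] K (pA x1 ⊗ pB x2).
Proof.
move=> HK; rewrite (comul_pApB (K := fun a b => K (a ⊗ b))) //.
by rewrite -(lin_tsumE _ _ HK) tsum_id.
Qed.

Lemma expand_mul_pure (U : lmodType k) (K : H -> U) x a b : lin K ->
  K (x ∙ (a ⊗ b)) = \tsum[x1, x2 <- Delta x] K ((x1 ▹ a) ⊗ (pB x2 * b)).
Proof. by move=> HK; rewrite mul_pure (lin_tsumE _ _ HK). Qed.

Section Lift.
Variables (S : H ⨂ B) (N : lmodType k) (actN : H -> N -> N) (G : N ⨂ A).
Hypothesis bilin_actN : bilin actN.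
Hypothesis actNM : forall x y n, actN (x ∙ y) n = actN x (actN y n).
Hypothesis comulS1 : forall (U : lmodType k) (K : H -> H -> B -> U), trilin K ->
  \tsum[s1, s2 <- S] \tsum[h1, h2 <- Delta s1] K h1 h2 s2 =
  \tsum[s1, s2 <- S] \tsum[r1, r2 <- S] K s1 r1 (s2 * r2).
Hypothesis comulS2 : forall (U : lmodType k) (K : H -> B -> B -> U), trilin K ->
  \tsum[s1, s2 <- S] \tsum[b1, b2 <- DeltaB s2] K s1 b1 b2 =
  \tsum[s1, s2 <- S] \tsum[r1, r2 <- S] K (s1 ∙ r1) r2 s2.

Definition lift : N ⨂ H :=
  \tsum[s1, s2 <- S] \tsum[g1, g2 <- G] actN s1 g1 ⊗ (g2 ⊗ s2).

Lemma liftE (U : lmodType k) (K : N -> H -> U) : bilin K ->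
  tsum lift K =
  \tsum[s1, s2 <- S] \tsum[g1, g2 <- G] K (actN s1 g1) (g2 ⊗ s2).
Proof.
move=> HK; rewrite tsum_tsum //; apply: eq_tsum => s1 s2.
by rewrite tsum_tsum //; apply: eq_tsum => g1 g2; rewrite tsumE.
Qed.

(** Projecting the second half of the second leg to B leaves only the leg of S
    to be comultiplied. *)
Lemma lift_comul_pB (U : lmodType k) (K : N -> H -> B -> U) : trilin K ->
  \tsum[p1, p2 <- lift] \tsum[h1, h2 <- Delta p2] K p1 h1 (pB h2) =
  \tsum[s1, s2 <- S] \tsum[p1, p2 <- lift] K (actN s1 p1) p2 s2.
Proof.
move=> HK; rewrite liftE //.
transitivity (\tsum[s1, s2 <- S] \tsum[b1, b2 <- DeltaB s2]
  \tsum[g1, g2 <- G] K (actN s1 g1) (g2 ⊗ b1) b2).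
  apply: eq_tsum => s1 s2; rewrite tsum_exch; apply: eq_tsum => g1 g2.
  by rewrite (comul_pB_pure (K := K (actN s1 g1))).
rewrite (comulS2 (K := fun h b1 b2 =>
  \tsum[g1, g2 <- G] K (actN h g1) (g2 ⊗ b1) b2)) //.
apply: eq_tsum => s1 s2; rewrite liftE //.
by do 2!apply: eq_tsum => ? ?; rewrite actNM.
Qed.

Section Comul.
Variable DN : N -> N ⨂ N.
Hypothesis lin_DN : lin DN.
Hypothesis actN_comul :
  forall (U : lmodType k) (K : N -> N -> U) h n, bilin K ->
  tsum (DN (actN h n)) K =
  \tsum[h1, h2 <- Delta h] \tsum[n1, n2 <- DN n] K (actN h1 n1) (actN h2 n2).
Hypothesis comulG : forall (U : lmodType k) (K : N -> N -> A -> U), trilin K ->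
  \tsum[g1, g2 <- G] \tsum[n1, n2 <- DN g1] K n1 n2 g2 =
  \tsum[p1, p2 <- lift] \tsum[g1, g2 <- G] K p1 g1 (p2 ▹ g2).

(** Both sides reduce to sums of s1 p1 ⊗ r1 g1 ⊗ ((p2 ▹ g2) ⊗ s2 r2): the left
    one by comultiplying s1 and g1 separately, the right one by multiplying
    p2 with g2 ⊗ r2, where lift_comul_pB splits p2. *)
Lemma lift_comul1 (U : lmodType k) (K : N -> N -> H -> U) : trilin K ->
  \tsum[p1, p2 <- lift] \tsum[n1, n2 <- DN p1] K n1 n2 p2 =
  \tsum[p1, p2 <- lift] \tsum[q1, q2 <- lift] K p1 q1 (p2 ∙ q2).
Proof.
move=> HK; rewrite liftE //.
transitivity (\tsum[s1, s2 <- S] \tsum[h1, h2 <- Delta s1] \tsum[g1, g2 <- G]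
  \tsum[n1, n2 <- DN g1] K (actN h1 n1) (actN h2 n2) (g2 ⊗ s2)).
  apply: eq_tsum => s1 s2; rewrite tsum_exch; apply: eq_tsum => g1 g2.
  by rewrite (actN_comul (K := fun n1 n2 => K n1 n2 (g2 ⊗ s2))).
rewrite (comulS1 (K := fun h1 h2 b => \tsum[g1, g2 <- G]
  \tsum[n1, n2 <- DN g1] K (actN h1 n1) (actN h2 n2) (g2 ⊗ b))) //.
transitivity (\tsum[s1, s2 <- S] \tsum[r1, r2 <- S]
  \tsum[p1, p2 <- lift] \tsum[g1, g2 <- G]
    K (actN s1 p1) (actN r1 g1) ((p2 ▹ g2) ⊗ (s2 * r2))).
  do 2!apply: eq_tsum => ? ?; rewrite (comulG (K := fun n1 n2 a =>
    K (actN _ n1) (actN _ n2) (a ⊗ _))) //.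
symmetry.
transitivity (\tsum[p1, p2 <- lift] \tsum[h1, h2 <- Delta p2]
  \tsum[s1, s2 <- S] \tsum[g1, g2 <- G]
    K p1 (actN s1 g1) ((h1 ▹ g2) ⊗ (pB h2 * s2))).
  apply: eq_tsum => p1 p2; rewrite liftE // [RHS]tsum_exch; apply: eq_tsum => s1 s2.
  rewrite [RHS]tsum_exch; apply: eq_tsum => g1 g2.
  by rewrite (expand_mul_pure (K := K p1 (actN s1 g1))).
rewrite (lift_comul_pB (K := fun n h b => \tsum[s1, s2 <- S]
  \tsum[g1, g2 <- G] K n (actN s1 g1) ((h ▹ g2) ⊗ (b * s2)))) //.
by apply: eq_tsum => s1 s2; rewrite tsum_exch.
Qed.
End Comul.

Section Braid.
Variable R : H ⨂ H.
Hypothesis comulR_pB :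
  forall (U : lmodType k) (K : H -> H -> B -> U), trilin K ->
  \tsum[r1, r2 <- R] \tsum[h1, h2 <- Delta r2] K r1 h1 (pB h2) =
  \tsum[s1, s2 <- S] \tsum[r1, r2 <- R] K (s1 ∙ r1) r2 s2.
Hypothesis braid_HB : forall (U : lmodType k) (K : H -> B -> U) h, bilin K ->
  \tsum[s1, s2 <- S] \tsum[h1, h2 <- Delta h] K (s1 ∙ h1) (s2 * pB h2) =
  \tsum[h1, h2 <- Delta h] \tsum[s1, s2 <- S] K (h2 ∙ s1) (pB h1 * s2).
Variable pN : H -> N.
Hypothesis lin_pN : lin pN.
Hypothesis braidG : forall (U : lmodType k) (K : N -> A -> U) h, bilin K ->
  \tsum[r1, r2 <- R] \tsum[h1, h2 <- Delta h]
    K (actN r1 (pN h1)) (r2 ▹ pA h2) =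
  \tsum[h1, h2 <- Delta h] \tsum[g1, g2 <- G] K (actN h2 g1) (h1 ▹ g2).

(** Expand the second leg r2 h2 through its projections.  The part in A is
    governed by the hypothesis on G, the part in B by the one on S, and
    coassociativity regroups the three copies of h in between. *)
Lemma lift_braid (U : lmodType k) (K : N -> H -> U) h : bilin K ->
  \tsum[r1, r2 <- R] \tsum[h1, h2 <- Delta h] K (actN r1 (pN h1)) (r2 ∙ h2) =
  \tsum[h1, h2 <- Delta h] \tsum[p1, p2 <- lift] K (actN h2 p1) (h1 ∙ p2).
Proof.
move=> HK.
transitivity (\tsum[h1, h2 <- Delta h] \tsum[h21, h22 <- Delta h2]
  \tsum[r1, r2 <- R] \tsum[x1, x2 <- Delta r2]
  K (actN r1 (pN h1)) ((x1 ▹ pA h21) ⊗ (pB x2 * pB h22))).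
  rewrite tsum_exch; apply: eq_tsum => h1 h2.
  rewrite tsum_exch; apply: eq_tsum => r1 r2.
  rewrite (expand_pApB (K := K (actN r1 (pN h1)))) //.
  rewrite (comulM (K := fun x y => K (actN r1 (pN h1)) (pA x ⊗ pB y))) //.
  by rewrite tsum_exch; do 2!apply: eq_tsum => ? ?; rewrite pAM pBM.
transitivity (\tsum[h1, h2 <- Delta h] \tsum[h21, h22 <- Delta h2]
  \tsum[s1, s2 <- S] \tsum[r1, r2 <- R]
  K (actN s1 (actN r1 (pN h1))) ((r2 ▹ pA h21) ⊗ (s2 * pB h22))).
  do 2!apply: eq_tsum => ? ?; rewrite (comulR_pB (K := fun r1 x1 b =>
    K (actN r1 (pN _)) ((x1 ▹ pA _) ⊗ (b * pB _)))) //.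
  by do 2!apply: eq_tsum => ? ?; rewrite actNM.
(* Group the first two copies of h, to which the hypothesis on G applies. *)
rewrite -(coassoc coalgH (K := fun h1 h2 h3 => \tsum[s1, s2 <- S]
  \tsum[r1, r2 <- R]
  K (actN s1 (actN r1 (pN h1))) ((r2 ▹ pA h2) ⊗ (s2 * pB h3)))) //.
transitivity (\tsum[h1, h2 <- Delta h] \tsum[h11, h12 <- Delta h1]
  \tsum[s1, s2 <- S] \tsum[g1, g2 <- G]
  K (actN (s1 ∙ h12) g1) ((h11 ▹ g2) ⊗ (s2 * pB h2))).
  apply: eq_tsum => h1 h2.
  rewrite tsum_exch [RHS]tsum_exch; apply: eq_tsum => s1 s2.
  rewrite tsum_exch (braidG (K := fun n a =>
    K (actN s1 n) (a ⊗ (s2 * pB h2)))) //.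
  by do 2!apply: eq_tsum => ? ?; rewrite actNM.
(* Group the last two copies, to which the hypothesis on S applies. *)
rewrite (coassoc coalgH (K := fun h1 h2 h3 => \tsum[s1, s2 <- S]
  \tsum[g1, g2 <- G] K (actN (s1 ∙ h2) g1) ((h1 ▹ g2) ⊗ (s2 * pB h3)))) //.
transitivity (\tsum[h1, h2 <- Delta h] \tsum[h21, h22 <- Delta h2]
  \tsum[s1, s2 <- S] \tsum[g1, g2 <- G]
  K (actN (h22 ∙ s1) g1) ((h1 ▹ g2) ⊗ (pB h21 * s2))).
  apply: eq_tsum => h1 h2; rewrite tsum_exch.
  by rewrite (braid_HB (K := fun x b =>
    \tsum[g1, g2 <- G] K (actN x g1) ((h1 ▹ g2) ⊗ b))).
rewrite -(coassoc coalgH (K := fun h1 h2 h3 => \tsum[s1, s2 <- S]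
  \tsum[g1, g2 <- G] K (actN (h3 ∙ s1) g1) ((h1 ▹ g2) ⊗ (pB h2 * s2)))) //.
apply: eq_tsum => h1 h2; rewrite liftE // tsum_exch.
apply: eq_tsum => s1 s2; rewrite tsum_exch; apply: eq_tsum => g1 g2.
by rewrite actNM (expand_mul_pure (K := K _)).
Qed.
End Braid.
End Lift.

(** * The four corners and the element they determine *)

(** Applies a linear f to both sides of the equation E between nested sums and
    evaluates it on the summands with tacL and tacR. *)
Ltac transport f Hf E tacL tacR :=
  lazymatch type of E with
  | ?s = ?t =>
    transitivity (f s); [symmetry; push_tsum Hf tacL |
      transitivity (f t); [by rewrite E | push_tsum Hf tacR]]
  end.
Ltac transport2 HK E tacL tacR :=
  lazymatch type of HK with bilin ?K =>
    transport (fun t => tsum t K) (lin_tsum HK) E tacL tacR end.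
Ltac transport3 HK E tacL tacR :=
  lazymatch type of HK with trilin ?K =>
    transport (tsum3 K) (lin_tsum3 HK) E tacL tacR end.
Ltac leaf2 := by rewrite tsumE.
Ltac leaf3 := by rewrite tsum3E.

Section Elements.
Variables (W : B ⨂ B) (X : A ⨂ B) (Y : B ⨂ A) (Z : A ⨂ A).
Hypothesis normW : normalized epsB epsB 1 1 W.
Hypothesis normX : normalized epsA epsB 1 1 X.
Hypothesis normY : normalized epsB epsA 1 1 Y.
Hypothesis normZ : normalized epsA epsA 1 1 Z.

Hypothesis C1 : forall a : A,
    \tsum[z1, z2 <- Z] \tsum[u1, u2 <- X] \tsum[x1, x2 <- X]
    \tsum[w1, w2 <- W] \tsum[y1, y2 <- Y] \tsum[a1, a2 <- DeltaA a]
    \tsum[i1, z1t1 <- tau (z1 ⊗ 1)]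
    \tsum[i2, z1t12 <- tau (z1t1 ⊗ 1)]
    \tsum[i3, u1t3 <- tau (u1 ⊗ 1)]
    \tsum[y2s1, u2s1 <- sigma (u2 ⊗ y2)]
    \tsum[y2s12, i1s2 <- sigma (i1 ⊗ y2s1)]
    \tsum[a1s3, w1y1s3 <- sigma ((w1 * y1) ⊗ a1)]
    \tsum[a2s4, p_s4 <- sigma ((i2 * i3 * x2 * w2) ⊗ a2)]
      (epsB w1y1s3 *: (z1t12 * u1t3 * x1 * a1s3))
        ⊗ (epsB (i1s2 * u2s1) *: (epsB p_s4 *: (z2 * y2s12 * a2s4)))
    = \tsum[z1, z2 <- Z] \tsum[a1, a2 <- DeltaA a]
      \tsum[i, a2t <- tau (a2 ⊗ 1)]
      \tsum[z2s, is_ <- sigma (i ⊗ z2)]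
        (a2t * z1) ⊗ (epsB is_ *: (a1 * z2s)).
Hypothesis C2 : forall a : A,
    \tsum[x1, x2 <- X] \tsum[w1, w2 <- W]
    \tsum[as_, w1s <- sigma (w1 ⊗ a)]
      (epsB w1s *: (x1 * as_)) ⊗ (x2 * w2)
    = \tsum[x1, x2 <- X] \tsum[i, at_ <- tau (a ⊗ 1)]
        (at_ * x1) ⊗ (i * x2).
Hypothesis C3 : forall a : A,
    \tsum[w1, w2 <- W] \tsum[y1, y2 <- Y]
    \tsum[i, at_ <- tau (a ⊗ 1)]
    \tsum[ats, w2s <- sigma (w2 ⊗ at_)]
      (w1 * y1 * i) ⊗ (epsB w2s *: (y2 * ats))
    = \tsum[y1, y2 <- Y] y1 ⊗ (a * y2).
Hypothesis C4 : forall b : B,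
    \tsum[z1, z2 <- Z] z1 ⊗ (epsB b *: z2)
    = \tsum[z1, z2 <- Z] \tsum[b1, b2 <- DeltaB b]
      \tsum[b1t, j <- tau (1 ⊗ b1)]
      \tsum[z1s1, b2s1 <- sigma (b2 ⊗ z1)]
      \tsum[z2s2, b1ts2 <- sigma (b1t ⊗ z2)]
        (j * z1s1) ⊗ (epsB b1ts2 *: (epsB b2s1 *: z2s2)).
Hypothesis C5 : forall b : B,
    \tsum[x1, x2 <- X] x1 ⊗ (x2 * b)
    = \tsum[x1, x2 <- X] \tsum[b1, b2 <- DeltaB b]
      \tsum[b1t, j <- tau (1 ⊗ b1)]
      \tsum[x1s, b2s <- sigma (b2 ⊗ x1)]
        (epsB b2s *: (j * x1s)) ⊗ (b1t * x2).
Hypothesis C6 : forall b : B,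
    \tsum[w1, w2 <- W] \tsum[y1, y2 <- Y]
    \tsum[bt, j <- tau (1 ⊗ b)]
    \tsum[js, w2s <- sigma (w2 ⊗ j)]
      (w1 * y1 * bt) ⊗ (epsB w2s *: (y2 * js))
    = \tsum[y1, y2 <- Y] \tsum[y2s, bs <- sigma (b ⊗ y2)]
        (bs * y1) ⊗ y2s.
Hypothesis C7 : forall b : B,
    \tsum[w1, w2 <- W] \tsum[b1, b2 <- DeltaB b] (w1 * b1) ⊗ (w2 * b2)
    = \tsum[w1, w2 <- W] \tsum[b1, b2 <- DeltaB b] (b2 * w1) ⊗ (b1 * w2).
Hypothesis C8 :
    \tsum[z1, z2 <- Z] \tsum[z11, z12 <- DeltaA z1] z11 ⊗ z12 ⊗ z2
    = \tsum[z1, z2 <- Z] \tsum[x1, x2 <- X] \tsum[v1, v2 <- Z]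
      \tsum[i, z1t <- tau (z1 ⊗ 1)]
      \tsum[v2s, ix2s <- sigma ((i * x2) ⊗ v2)]
        (z1t * x1) ⊗ v1 ⊗ (epsB ix2s *: (z2 * v2s)).
Hypothesis C9 :
    \tsum[x1, x2 <- X] \tsum[x11, x12 <- DeltaA x1] x11 ⊗ x12 ⊗ x2
    = \tsum[x1, x2 <- X] \tsum[u1, u2 <- X] x1 ⊗ u1 ⊗ (x2 * u2).
Hypothesis C10 :
    \tsum[z1, z2 <- Z] \tsum[x1, x2 <- X] \tsum[y1, y2 <- Y]
    \tsum[i, z1t2 <- tau (z1 ⊗ 1)]
    \tsum[y1t1, z1t2x1t1 <- tau ((z1t2 * x1) ⊗ y1)]
    \tsum[y2s, ix2s <- sigma ((i * x2) ⊗ y2)]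
      y1t1 ⊗ z1t2x1t1 ⊗ (epsB ix2s *: (z2 * y2s))
    = \tsum[w1, w2 <- W] \tsum[y1, y2 <- Y] \tsum[z1, z2 <- Z]
      \tsum[z2s, w2s <- sigma (w2 ⊗ z2)]
        (w1 * y1) ⊗ z1 ⊗ (epsB w2s *: (y2 * z2s)).
Hypothesis C11 :
    \tsum[w1, w2 <- W] \tsum[x1, x2 <- X]
    \tsum[w1t, x1t <- tau (x1 ⊗ w1)]
      w1t ⊗ x1t ⊗ (x2 * w2)
    = \tsum[w1, w2 <- W] \tsum[x1, x2 <- X] w1 ⊗ x1 ⊗ (w2 * x2).
Hypothesis C12 :
    \tsum[y1, y2 <- Y] \tsum[y11, y12 <- DeltaB y1] y11 ⊗ y12 ⊗ y2
    = \tsum[w1, w2 <- W] \tsum[y1, y2 <- Y] \tsum[v1, v2 <- Y]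
      \tsum[v2s, w2s <- sigma (w2 ⊗ v2)]
        (w1 * y1) ⊗ v1 ⊗ (epsB w2s *: (y2 * v2s)).
Hypothesis C13 :
    \tsum[w1, w2 <- W] \tsum[w11, w12 <- DeltaB w1] w11 ⊗ w12 ⊗ w2
    = \tsum[w1, w2 <- W] \tsum[v1, v2 <- W] w1 ⊗ v1 ⊗ (w2 * v2).
Hypothesis C14 :
    \tsum[z1, z2 <- Z] \tsum[z21, z22 <- DeltaA z2] z1 ⊗ z21 ⊗ z22
    = \tsum[z1, z2 <- Z] \tsum[x1, x2 <- X] \tsum[v1, v2 <- Z]
      \tsum[y1, y2 <- Y]
      \tsum[i, z1t <- tau (z1 ⊗ 1)]
      \tsum[v1s1, y1s1 <- sigma (y1 ⊗ v1)]
      \tsum[y2s2, ix2s2 <- sigma ((i * x2) ⊗ y2)]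
        (epsB y1s1 *: (z1t * x1 * v1s1)) ⊗ v2 ⊗ (epsB ix2s2 *: (z2 * y2s2)).
Hypothesis C15 :
    \tsum[z1, z2 <- Z] \tsum[x1, x2 <- X]
    \tsum[i, z1t1 <- tau (z1 ⊗ 1)]
    \tsum[ix2t2, z2t2 <- tau (z2 ⊗ (i * x2))]
      (z1t1 * x1) ⊗ ix2t2 ⊗ z2t2
    = \tsum[z1, z2 <- Z] \tsum[x1, x2 <- X] \tsum[u1, u2 <- X]
      \tsum[y1, y2 <- Y]
      \tsum[i, z1t <- tau (z1 ⊗ 1)]
      \tsum[u1s1, y1s1 <- sigma (y1 ⊗ u1)]
      \tsum[y2s2, ix2s2 <- sigma ((i * x2) ⊗ y2)]
        (epsB y1s1 *: (z1t * x1 * u1s1)) ⊗ u2 ⊗ (epsB ix2s2 *: (z2 * y2s2)).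
Hypothesis C16 :
    \tsum[x1, x2 <- X] \tsum[x21, x22 <- DeltaB x2] x1 ⊗ x21 ⊗ x22
    = \tsum[x1, x2 <- X] \tsum[u1, u2 <- X] \tsum[w1, w2 <- W]
      \tsum[u1s, w1s <- sigma (w1 ⊗ u1)]
        (epsB w1s *: (x1 * u1s)) ⊗ u2 ⊗ (x2 * w2).
Hypothesis C17 :
    \tsum[y1, y2 <- Y] \tsum[y21, y22 <- DeltaA y2] y1 ⊗ y21 ⊗ y22
    = \tsum[y1, y2 <- Y] \tsum[v1, v2 <- Y] (y1 * v1) ⊗ v2 ⊗ y2.
Hypothesis C18 :
    \tsum[w1, w2 <- W] \tsum[y1, y2 <- Y]
    \tsum[w2t, y2t <- tau (y2 ⊗ w2)]
      (w1 * y1) ⊗ w2t ⊗ y2t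
    = \tsum[w1, w2 <- W] \tsum[y1, y2 <- Y] (y1 * w1) ⊗ w2 ⊗ y2.
Hypothesis C19 :
    \tsum[w1, w2 <- W] \tsum[w21, w22 <- DeltaB w2] w1 ⊗ w21 ⊗ w22
    = \tsum[w1, w2 <- W] \tsum[v1, v2 <- W] (w1 * v1) ⊗ v2 ⊗ w2.

(** The five elements are candidates for the images of the quasitriangular
    structure under id ⊗ pB, pA ⊗ id, pB ⊗ id, id ⊗ pA and id ⊗ id. *)
Definition RHB : H ⨂ B :=
  \tsum[x1, x2 <- X] \tsum[w1, w2 <- W] (x1 ⊗ w1) ⊗ (x2 * w2).
Local Notation actB := (fun h b => pB h * b).
Definition RAH : A ⨂ H := lift RHB act Z.
Definition RBH : B ⨂ H := lift RHB actB Y.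
Definition RHA : H ⨂ A :=
  \tsum[p1, p2 <- RAH] \tsum[y1, y2 <- Y] (p1 ⊗ y1) ⊗ (p2 ▹ y2).
Definition RHH : H ⨂ H := lift RHB (smash_mul sigma) RHA.

Lemma bilin_actA : bilin act. Proof. by []. Qed.
Lemma bilin_actB : bilin actB. Proof. by []. Qed.
Lemma bilin_actH : bilin (smash_mul sigma). Proof. by []. Qed.
Lemma actHM x y z : x ∙ y ∙ z = x ∙ (y ∙ z).
Proof. by rewrite smash_mulA. Qed.
Lemma actBM x y b : pB (x ∙ y) * b = pB x * (pB y * b).
Proof. by rewrite pBM mulrA. Qed.

Section CornerSums.
Variable U : lmodType k.

Lemma tsum_RHB (K : H -> B -> U) : bilin K ->
  tsum RHB K = \tsum[x1, x2 <- X] \tsum[w1, w2 <- W] K (x1 ⊗ w1) (x2 * w2).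
Proof.
move=> HK; rewrite tsum_tsum //; apply: eq_tsum => x1 x2.
by rewrite tsum_tsum //; apply: eq_tsum => w1 w2; rewrite tsumE.
Qed.

Lemma tsum_RHA (K : H -> A -> U) : bilin K ->
  tsum RHA K = \tsum[p1, p2 <- RAH] \tsum[y1, y2 <- Y] K (p1 ⊗ y1) (p2 ▹ y2).
Proof.
move=> HK; rewrite tsum_tsum //; apply: eq_tsum => p1 p2.
by rewrite tsum_tsum //; apply: eq_tsum => y1 y2; rewrite tsumE.
Qed.

Lemma tsum_RAH (K : A -> H -> U) : bilin K ->
  tsum RAH K = \tsum[s1, s2 <- RHB] \tsum[z1, z2 <- Z] K (s1 ▹ z1) (z2 ⊗ s2).
Proof. by move=> HK; rewrite /RAH liftE. Qed.

Lemma tsum_RHH (K : H -> H -> U) : bilin K ->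
  tsum RHH K = \tsum[s1, s2 <- RHB] \tsum[t1, t2 <- RHA] K (s1 ∙ t1) (t2 ⊗ s2).
Proof. by move=> HK; rewrite /RHH liftE. Qed.

(** Normalization in the form used for substitution in the second leg. *)
Lemma norml (V V' : lmodType k) (e : {scalar V}) (e' : {scalar V'}) u u'
    (t : V ⨂ V') (F : V' -> U) :
  normalized e e' u u' t -> lin F -> \tsum[v, v' <- t] e v *: F v' = F u'.
Proof.
case=> <- _ HF; rewrite (lin_tsumE _ _ HF).
by apply: eq_tsum => v v'; rewrite (linZ _ _ HF).
Qed.

Lemma normr (V V' : lmodType k) (e : {scalar V}) (e' : {scalar V'}) u u'
    (t : V ⨂ V') (F : V -> U) :
  normalized e e' u u' t -> lin F -> \tsum[v, v' <- t] e' v' *: F v = F u.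
Proof.
case=> _ <- HF; rewrite (lin_tsumE _ _ HF).
by apply: eq_tsum => v v'; rewrite (linZ _ _ HF).
Qed.

(** Applying pB to the first leg kills X by normalization. *)
Lemma RHB_pB (K : B -> B -> U) : bilin K ->
  \tsum[s1, s2 <- RHB] K (pB s1) s2 = tsum W K.
Proof.
move=> HK; rewrite (tsum_RHB (K := fun h => K (pB h))) // tsum_exch.
apply: eq_tsum => w1 w2.
rewrite -[in RHS](mul1r w2) -(norml (F := fun b => K w1 (b * w2)) normX) //.
by apply: eq_tsum => x1 x2; rewrite pBE (linZ _ _ (bilin1 _ HK)).
Qed.

(** Only the image W of RHB under pB ⊗ id acts on Y. *)
Lemma tsum_RBH (K : B -> H -> U) : bilin K ->
  tsum RBH K = \tsum[w1, w2 <- W] \tsum[y1, y2 <- Y] K (w1 * y1) (y2 ⊗ w2).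
Proof.
move=> HK; rewrite /RBH liftE //.
by rewrite (RHB_pB (K := fun b b' => \tsum[y1, y2 <- Y] K (b * y1) (y2 ⊗ b'))).
Qed.

End CornerSums.

(** * Comultiplying the corner in H ⨂ B *)

(** The hypotheses are used from here on in evaluated form, one lemma for each
    of them. *)
Lemma X_comul1 (U : lmodType k) (K : A -> A -> B -> U) : trilin K ->
  \tsum[x1, x2 <- X] \tsum[a1, a2 <- DeltaA x1] K a1 a2 x2 =
  \tsum[x1, x2 <- X] \tsum[u1, u2 <- X] K x1 u1 (x2 * u2).
Proof. by move=> HK; transport3 HK C9 leaf3 leaf3. Qed.

Lemma W_comul1 (U : lmodType k) (K : B -> B -> B -> U) : trilin K ->
  \tsum[w1, w2 <- W] \tsum[b1, b2 <- DeltaB w1] K b1 b2 w2 =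
  \tsum[w1, w2 <- W] \tsum[v1, v2 <- W] K w1 v1 (w2 * v2).
Proof. by move=> HK; transport3 HK C13 leaf3 leaf3. Qed.

Lemma tau_X_W (U : lmodType k) (K : B -> A -> B -> U) : trilin K ->
  \tsum[x1, x2 <- X] \tsum[w1, w2 <- W] \tsum[b, a <- tau (x1 ⊗ w1)]
    K b a (x2 * w2) =
  \tsum[w1, w2 <- W] \tsum[x1, x2 <- X] K w1 x1 (w2 * x2).
Proof.
by move=> HK; rewrite tsum_exch; transport3 HK C11 leaf3 leaf3.
Qed.

(** The case P = X, Q = Y = W of comul_two_factors. *)
Lemma RHB_comul1 (U : lmodType k) (K : H -> H -> B -> U) : trilin K ->
  \tsum[s1, s2 <- RHB] \tsum[h1, h2 <- Delta s1] K h1 h2 s2 =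
  \tsum[s1, s2 <- RHB] \tsum[r1, r2 <- RHB] K s1 r1 (s2 * r2).
Proof.
move=> HK; rewrite tsum_RHB // tsum_RHB //.
have bm : bilin (fun b c : B => b * c) by [].
have mM (c d m : B) : c * d * m = c * (d * m) by rewrite mulrA.
rewrite (comul_two_factors bm mM X_comul1 W_comul1 tau_X_W) //.
do 2!apply: eq_tsum => ? ?; rewrite tsum_RHB //.
by do 2!apply: eq_tsum => ? ?; rewrite !mulrA.
Qed.

Lemma RHB_comul1_pB (U : lmodType k) (K : H -> B -> B -> U) : trilin K ->
  \tsum[s1, s2 <- RHB] \tsum[h1, h2 <- Delta s1] K h1 (pB h2) s2 =
  \tsum[s1, s2 <- RHB] \tsum[w1, w2 <- W] K s1 w1 (s2 * w2).
Proof.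
move=> HK; rewrite (RHB_comul1 (K := fun x y => K x (pB y))) //.
apply: eq_tsum => s1 s2.
by rewrite (RHB_pB (K := fun b c => K s1 b (s2 * c))).
Qed.

Lemma X_comul2 (U : lmodType k) (K : A -> B -> B -> U) : trilin K ->
  \tsum[x1, x2 <- X] \tsum[b1, b2 <- DeltaB x2] K x1 b1 b2 =
  \tsum[s1, s2 <- RHB] \tsum[u1, u2 <- X] K (s1 ▹ u1) u2 s2.
Proof.
move=> HK; rewrite tsum_RHB //.
transitivity (\tsum[x1, x2 <- X] \tsum[u1, u2 <- X] \tsum[w1, w2 <- W]
  K (x1 * ((1 ⊗ w1) ▹ u1)) u2 (x2 * w2)); last first.
  apply: eq_tsum => x1 x2; rewrite tsum_exch.
  by do 2!apply: eq_tsum => ? ?; rewrite act_pure.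
transport3 HK C16 leaf3 ltac:(
  rewrite (lin_tsumE _ _ (lin_tsum3 HK)) -(sigma_act_mul (F := fun a => K a _ _)) //;
  by apply: eq_tsum => ? ?; rewrite tsum3E).
Qed.

Lemma W_comul2 (U : lmodType k) (K : B -> B -> B -> U) : trilin K ->
  \tsum[w1, w2 <- W] \tsum[b1, b2 <- DeltaB w2] K w1 b1 b2 =
  \tsum[w1, w2 <- W] \tsum[v1, v2 <- W] K (w1 * v1) v2 w2.
Proof. by move=> HK; transport3 HK C19 leaf3 leaf3. Qed.

(** Multiplicativity of the coproduct of B splits x2 w2; on the other side
    s1 (x1 ⊗ v1) is expanded by mul_pure, and the coproduct of s1 that it
    contains is RHB_comul1. *)
Lemma RHB_comul2 (U : lmodType k) (K : H -> B -> B -> U) : trilin K ->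
  \tsum[s1, s2 <- RHB] \tsum[b1, b2 <- DeltaB s2] K s1 b1 b2 =
  \tsum[s1, s2 <- RHB] \tsum[r1, r2 <- RHB] K (s1 ∙ r1) r2 s2.
Proof.
move=> HK; rewrite tsum_RHB //.
transitivity (\tsum[x1, x2 <- X] \tsum[b1, b2 <- DeltaB x2]
  \tsum[w1, w2 <- W] \tsum[c1, c2 <- DeltaB w2]
  K (x1 ⊗ w1) (b1 * c1) (b2 * c2)).
  apply: eq_tsum => x1 x2; rewrite tsum_exch; apply: eq_tsum => w1 w2.
  by rewrite comulB_M.
rewrite (X_comul2 (K := fun a b1 b2 => \tsum[w1, w2 <- W]
  \tsum[c1, c2 <- DeltaB w2] K (a ⊗ w1) (b1 * c1) (b2 * c2))) //.
transitivity (\tsum[s1, s2 <- RHB] \tsum[w1, w2 <- W]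
  \tsum[x1, x2 <- X] \tsum[v1, v2 <- W]
  K ((s1 ▹ x1) ⊗ (w1 * v1)) (x2 * v2) (s2 * w2)).
  apply: eq_tsum => s1 s2; rewrite tsum_exch [LHS]tsum_exch.
  rewrite [RHS]tsum_exch; apply: eq_tsum => x1 x2.
  by rewrite (W_comul2 (K := fun a b c => K ((s1 ▹ x1) ⊗ a) (x2 * b) (s2 * c))).
rewrite -(RHB_comul1_pB (K := fun h b c => \tsum[x1, x2 <- X]
  \tsum[v1, v2 <- W] K ((h ▹ x1) ⊗ (b * v1)) (x2 * v2) c)) //.
apply: eq_tsum => s1 s2; rewrite tsum_RHB // tsum_exch; apply: eq_tsum => x1 x2.
rewrite tsum_exch; apply: eq_tsum => v1 v2.
by rewrite (expand_mul_pure (K := fun h => K h (x2 * v2) s2)).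
Qed.

Lemma RAH_comul_pB (U : lmodType k) (K : A -> H -> B -> U) : trilin K ->
  \tsum[p1, p2 <- RAH] \tsum[h1, h2 <- Delta p2] K p1 h1 (pB h2) =
  \tsum[s1, s2 <- RHB] \tsum[p1, p2 <- RAH] K (s1 ▹ p1) p2 s2.
Proof. exact: lift_comul_pB Z bilin_actA actM RHB_comul2 _ _. Qed.

Lemma RHH_comul_pB (U : lmodType k) (K : H -> H -> B -> U) : trilin K ->
  \tsum[r1, r2 <- RHH] \tsum[h1, h2 <- Delta r2] K r1 h1 (pB h2) =
  \tsum[s1, s2 <- RHB] \tsum[r1, r2 <- RHH] K (s1 ∙ r1) r2 s2.
Proof. exact: lift_comul_pB RHA bilin_actH actHM RHB_comul2 _ _. Qed.

Lemma RBH_comul_pB (U : lmodType k) (K : B -> H -> B -> U) : trilin K ->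
  \tsum[q1, q2 <- RBH] \tsum[h1, h2 <- Delta q2] K q1 h1 (pB h2) =
  \tsum[w1, w2 <- W] \tsum[q1, q2 <- RBH] K (w1 * q1) q2 w2.
Proof.
move=> HK; rewrite (lift_comul_pB Y bilin_actB actBM RHB_comul2) //.
by rewrite (RHB_pB (K := fun b c => \tsum[q1, q2 <- RBH] K (b * q1) q2 c)).
Qed.

(** * Two factorizations, and the expanded element *)

(** RHH was defined through the factorization that (id ⊗ Δ) R = R_13 R_12
    demands; this is the one that (Δ ⊗ id) R = R_13 R_23 demands.  Both equal
    Σ (s1 ▹ p1) ⊗ w1 y1 ⊗ (p2 ▹ y2) ⊗ s2 w2. *)
Lemma tsum_RHH_AB (U : lmodType k) (K : H -> H -> U) : bilin K ->
  tsum RHH K = \tsum[p1, p2 <- RAH] \tsum[q1, q2 <- RBH] K (p1 ⊗ q1) (p2 ∙ q2).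
Proof.
move=> HK.
transitivity (\tsum[s1, s2 <- RHB] \tsum[p1, p2 <- RAH] \tsum[w1, w2 <- W]
  \tsum[y1, y2 <- Y]
  K ((s1 ▹ p1) ⊗ (w1 * y1)) ((p2 ▹ y2) ⊗ (s2 * w2))).
  rewrite tsum_RHH //.
  transitivity (\tsum[s1, s2 <- RHB] \tsum[h1, h2 <- Delta s1]
    \tsum[p1, p2 <- RAH] \tsum[y1, y2 <- Y]
    K ((h1 ▹ p1) ⊗ (pB h2 * y1)) ((p2 ▹ y2) ⊗ s2)).
    apply: eq_tsum => s1 s2; rewrite tsum_RHA // [RHS]tsum_exch.
    apply: eq_tsum => p1 p2; rewrite [RHS]tsum_exch; apply: eq_tsum => y1 y2.
    by rewrite (expand_mul_pure (K := fun h => K h _)).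
  rewrite (RHB_comul1_pB (K := fun h b c => \tsum[p1, p2 <- RAH]
    \tsum[y1, y2 <- Y] K ((h ▹ p1) ⊗ (b * y1)) ((p2 ▹ y2) ⊗ c))) //.
  by apply: eq_tsum => s1 s2; rewrite tsum_exch.
rewrite -(RAH_comul_pB (K := fun a h b => \tsum[w1, w2 <- W]
  \tsum[y1, y2 <- Y] K (a ⊗ (w1 * y1)) ((h ▹ y2) ⊗ (b * w2)))) //.
apply: eq_tsum => p1 p2; rewrite tsum_RBH // tsum_exch; apply: eq_tsum => w1 w2.
rewrite tsum_exch; apply: eq_tsum => y1 y2.
by rewrite (expand_mul_pure (K := K _)).
Qed.

(** Besides being a commutation rule, this trades the action of W hidden in
    RHB for an application of tau; it is what relates RAH to the shape in which
    Z and X occur in the hypotheses. *)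
Lemma braid_AB_iA (U : lmodType k) (K : A -> B -> U) a : bilin K ->
  \tsum[s1, s2 <- RHB] K (s1 ▹ a) s2 =
  \tsum[x1, x2 <- X] \tsum[i, at_ <- tau (a ⊗ 1)] K (at_ * x1) (i * x2).
Proof.
move=> HK; rewrite tsum_RHB //.
transport2 HK (C2 a) ltac:(
  rewrite (lin_tsumE _ _ (lin_tsum HK)) act_pure;
  rewrite -(sigma_act_mul (F := fun a => K a _)) //;
  apply: eq_tsum => ? ?; leaf2) leaf2.
Qed.

(** Coassociativity of Δ at a ⊗ 1; it makes tau (a ⊗ 1) a coaction of B on A. *)
Lemma tau_coact (U : lmodType k) (K : B -> B -> A -> U) a : trilin K ->
  \tsum[i, at_ <- tau (a ⊗ 1)] \tsum[b1, b2 <- DeltaB i] K b1 b2 at_ =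
  \tsum[i1, at1 <- tau (a ⊗ 1)] \tsum[i2, at2 <- tau (at1 ⊗ 1)] K i1 i2 at2.
Proof.
move=> HK; rewrite -(comul_pBpA (K := fun i at_ =>
  \tsum[b1, b2 <- DeltaB i] K b1 b2 at_)) //.
transitivity (\tsum[h1, h2 <- Delta (a ⊗ 1)] \tsum[x1, x2 <- Delta h1]
  K (pB x1) (pB x2) (pA h2)).
  apply: eq_tsum => h1 h2.
  by rewrite -(comul_pBpB (K := fun b c => K b c (pA h2))).
rewrite (coassoc coalgH (K := fun x y z => K (pB x) (pB y) (pA z))) //.
transitivity (\tsum[h1, h2 <- Delta (a ⊗ 1)] \tsum[i2, at2 <- tau h2]
  K (pB h1) i2 at2).
  apply: eq_tsum => h1 h2.
  by rewrite (comul_pBpA (K := K (pB h1))).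
rewrite (comul_pB_pure_l (K := fun b h =>
  \tsum[i2, at2 <- tau h] K b i2 at2)) //.
by case: (smash_unitalB smashH) => -> _; rewrite tsumE.
Qed.

Lemma tsum_RAH_tau (U : lmodType k) (K : A -> H -> U) : bilin K ->
  tsum RAH K = \tsum[z1, z2 <- Z] \tsum[x1, x2 <- X]
    \tsum[i, at_ <- tau (z1 ⊗ 1)] K (at_ * x1) (z2 ⊗ (i * x2)).
Proof.
move=> HK; rewrite tsum_RAH // tsum_exch; apply: eq_tsum => z1 z2.
by rewrite (braid_AB_iA (K := fun a b => K a (z2 ⊗ b))).
Qed.

Lemma iBM b c : (1 ⊗ b) ∙ (1 ⊗ c) = 1 ⊗ (b * c).
Proof. by rewrite smash_mulE sigmaB1 tsumE // mulr1. Qed.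

(** Multiplying out the second leg (z2 ⊗ i x2) (y2 ⊗ w2) of RAH_13 RBH_23
    produces the coproducts of i and of x2.  The first is an iterated tau by
    tau_coact.  The second introduces a further copy u of X, whose action by W
    is again an application of tau. *)
Lemma tsum_RHH_expanded (U : lmodType k) (F : H -> H -> U) : bilin F ->
  \tsum[z1, z2 <- Z] \tsum[u1, u2 <- X] \tsum[x1, x2 <- X]
  \tsum[w1, w2 <- W] \tsum[y1, y2 <- Y]
  \tsum[i1, z1t1 <- tau (z1 ⊗ 1)]
  \tsum[i2, z1t12 <- tau (z1t1 ⊗ 1)]
  \tsum[i3, u1t3 <- tau (u1 ⊗ 1)]
  \tsum[y2s1, u2s1 <- sigma (u2 ⊗ y2)]
  \tsum[y2s12, i1s2 <- sigma (i1 ⊗ y2s1)]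
    F ((z1t12 * u1t3 * x1) ⊗ (w1 * y1))
      ((epsB (i1s2 * u2s1) *: (z2 * y2s12)) ⊗ (i2 * i3 * x2 * w2)) =
  tsum RHH F.
Proof.
move=> HF; rewrite tsum_RHH_AB // tsum_RAH_tau //; apply: eq_tsum => z1 z2.
transitivity (\tsum[u1, u2 <- X] \tsum[x1, x2 <- X]
  \tsum[i3, u1t3 <- tau (u1 ⊗ 1)] \tsum[w1, w2 <- W] \tsum[y1, y2 <- Y]
  \tsum[i1, z1t1 <- tau (z1 ⊗ 1)] \tsum[i2, z1t12 <- tau (z1t1 ⊗ 1)]
  F ((z1t12 * (u1t3 * x1)) ⊗ (w1 * y1))
    ((z2 * ((1 ⊗ (i1 * u2)) ▹ y2)) ⊗ (i2 * (i3 * x2) * w2))).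
  apply: eq_tsum => u1 u2; apply: eq_tsum => x1 x2; symmetry.
  rewrite tsum_exch; apply: eq_tsum => w1 w2.
  rewrite tsum_exch; apply: eq_tsum => y1 y2.
  rewrite tsum_exch; apply: eq_tsum => i1 z1t1.
  rewrite tsum_exch; apply: eq_tsum => i2 z1t12; apply: eq_tsum => i3 u1t3.
  rewrite -iBM actM.
  pose f a := F ((z1t12 * u1t3 * x1) ⊗ (w1 * y1))
    ((z2 * a) ⊗ (i2 * i3 * x2 * w2)).
  have lf : lin f by rewrite /f; multilin.
  have lg : lin (fun a => F ((z1t12 * u1t3 * x1) ⊗ (w1 * y1))
    (a ⊗ (i2 * i3 * x2 * w2))) by multilin.
  (* Two successive applications of sigma, each followed by epsB, are the
     action of the product i1 * u2. *)
  rewrite !mulrA; transitivity (f ((1 ⊗ i1) ▹ (1 ⊗ u2) ▹ y2)) => //.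
  rewrite -(sigma_act (F := fun a => f ((1 ⊗ i1) ▹ a))) //.
  apply: eq_tsum => y2s1 u2s1; rewrite -(sigma_act _ _ lf).
  rewrite tsumZ.
  by apply: eq_tsum => y2s12 i1s2; rewrite (linZ _ _ lg) scalerA mulrC epsBM.
symmetry.
transitivity (\tsum[x1, x2 <- X] \tsum[c1, c2 <- DeltaB x2]
  \tsum[w1, w2 <- W] \tsum[y1, y2 <- Y]
  \tsum[i1, z1t1 <- tau (z1 ⊗ 1)] \tsum[i2, z1t12 <- tau (z1t1 ⊗ 1)]
  F ((z1t12 * x1) ⊗ (w1 * y1))
    ((z2 * ((1 ⊗ (i1 * c1)) ▹ y2)) ⊗ (i2 * c2 * w2))).
  apply: eq_tsum => x1 x2.
  transitivity (\tsum[i, at_ <- tau (z1 ⊗ 1)] \tsum[w1, w2 <- W]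
    \tsum[y1, y2 <- Y]
    F ((at_ * x1) ⊗ (w1 * y1)) ((z2 ⊗ (i * x2)) ∙ (y2 ⊗ w2))).
    by apply: eq_tsum => i at_; rewrite tsum_RBH.
  rewrite tsum_exch [RHS]tsum_exch; apply: eq_tsum => w1 w2.
  rewrite tsum_exch [RHS]tsum_exch.
  apply: eq_tsum => y1 y2.
  transitivity (\tsum[i, at_ <- tau (z1 ⊗ 1)] \tsum[b1, b2 <- DeltaB i]
    \tsum[c1, c2 <- DeltaB x2] F ((at_ * x1) ⊗ (w1 * y1))
      ((z2 * ((1 ⊗ (b1 * c1)) ▹ y2)) ⊗ (b2 * c2 * w2))).
    apply: eq_tsum => i at_.
    by rewrite mul_pure_pure (lin_tsumE _ _ (bilin2 _ HF)) comulB_M.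
  rewrite (tau_coact (K := fun b1 b2 a => \tsum[c1, c2 <- DeltaB x2]
    F ((a * x1) ⊗ (w1 * y1))
      ((z2 * ((1 ⊗ (b1 * c1)) ▹ y2)) ⊗ (b2 * c2 * w2)))) //.
  rewrite [RHS]tsum_exch; apply: eq_tsum => i1 z1t1.
  by rewrite [RHS]tsum_exch.
rewrite (X_comul2 (K := fun a c1 c2 => \tsum[w1, w2 <- W] \tsum[y1, y2 <- Y]
  \tsum[i1, z1t1 <- tau (z1 ⊗ 1)] \tsum[i2, z1t12 <- tau (z1t1 ⊗ 1)]
  F ((z1t12 * a) ⊗ (w1 * y1))
  ((z2 * ((1 ⊗ (i1 * c1)) ▹ y2)) ⊗ (i2 * c2 * w2)))) //.
rewrite tsum_exch; apply: eq_tsum => u1 u2.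
by rewrite (braid_AB_iA (K := fun a b => \tsum[w1, w2 <- W] \tsum[y1, y2 <- Y]
  \tsum[i1, z1t1 <- tau (z1 ⊗ 1)] \tsum[i2, z1t12 <- tau (z1t1 ⊗ 1)]
  F ((z1t12 * a) ⊗ (w1 * y1))
  ((z2 * ((1 ⊗ (i1 * u2)) ▹ y2)) ⊗ (i2 * b * w2)))).
Qed.

(** * Comultiplication of the first leg *)

Lemma Z_comul1 (U : lmodType k) (K : A -> A -> A -> U) : trilin K ->
  \tsum[z1, z2 <- Z] \tsum[a1, a2 <- DeltaA z1] K a1 a2 z2 =
  \tsum[p1, p2 <- RAH] \tsum[v1, v2 <- Z] K p1 v1 (p2 ▹ v2).
Proof.
move=> HK; rewrite tsum_RAH_tau //.
transitivity (\tsum[z1, z2 <- Z] \tsum[x1, x2 <- X] \tsum[v1, v2 <- Z]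
  \tsum[i, at_ <- tau (z1 ⊗ 1)] K (at_ * x1) v1 ((z2 ⊗ (i * x2)) ▹ v2)).
  by transport3 HK C8 leaf3 ltac:(rewrite tsum3_sigma).
by do 2!apply: eq_tsum => ? ?; rewrite tsum_exch.
Qed.

Lemma Y_comul1 (U : lmodType k) (K : B -> B -> A -> U) : trilin K ->
  \tsum[y1, y2 <- Y] \tsum[b1, b2 <- DeltaB y1] K b1 b2 y2 =
  \tsum[q1, q2 <- RBH] \tsum[v1, v2 <- Y] K q1 v1 (q2 ▹ v2).
Proof.
move=> HK; rewrite tsum_RBH //.
by transport3 HK C12 leaf3 ltac:(rewrite tsum3_sigma).
Qed.

Lemma tau_RAH_Y (U : lmodType k) (K : B -> A -> A -> U) : trilin K ->
  \tsum[p1, p2 <- RAH] \tsum[y1, y2 <- Y] \tsum[b, a <- tau (p1 ⊗ y1)]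
    K b a (p2 ▹ y2) =
  \tsum[q1, q2 <- RBH] \tsum[z1, z2 <- Z] K q1 z1 (q2 ▹ z2).
Proof.
move=> HK; rewrite tsum_RBH // tsum_RAH_tau //.
transitivity (\tsum[z1, z2 <- Z] \tsum[x1, x2 <- X] \tsum[y1, y2 <- Y]
  \tsum[i, at_ <- tau (z1 ⊗ 1)] \tsum[b, a <- tau ((at_ * x1) ⊗ y1)]
  K b a ((z2 ⊗ (i * x2)) ▹ y2)).
  by do 2!apply: eq_tsum => ? ?; rewrite tsum_exch.
by transport3 HK C10 ltac:(rewrite tsum3_sigma) ltac:(rewrite tsum3_sigma).
Qed.

Lemma RAH_comul1 (U : lmodType k) (K : A -> A -> H -> U) : trilin K ->
  \tsum[p1, p2 <- RAH] \tsum[a1, a2 <- DeltaA p1] K a1 a2 p2 =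
  \tsum[p1, p2 <- RAH] \tsum[q1, q2 <- RAH] K p1 q1 (p2 ∙ q2).
Proof.
have linD : lin DeltaA by [].
apply: (lift_comul1 bilin_actA actM RHB_comul1 RHB_comul2 linD _ Z_comul1).
exact: act_comul.
Qed.

Lemma RBH_comul1 (U : lmodType k) (K : B -> B -> H -> U) : trilin K ->
  \tsum[q1, q2 <- RBH] \tsum[b1, b2 <- DeltaB q1] K b1 b2 q2 =
  \tsum[q1, q2 <- RBH] \tsum[r1, r2 <- RBH] K q1 r1 (q2 ∙ r2).
Proof.
have linD : lin DeltaB by [].
apply: (lift_comul1 bilin_actB actBM RHB_comul1 RHB_comul2 linD _ Y_comul1).
move=> U' K' h b HK'; rewrite comulB_M //.
by rewrite -(comul_pBpB (K := fun b1 b2 =>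
  \tsum[n1, n2 <- DeltaB b] K' (b1 * n1) (b2 * n2))).
Qed.

(** The exchange hypothesis needed for comul_two_factors at RHA.  The left side
    is tau applied to the first leg of RHH; in the factorization through RHB
    and RHA it is governed by the product rule for tau. *)
Lemma tau_RAH_RBH (U : lmodType k) (K : B -> A -> H -> U) : trilin K ->
  \tsum[p1, p2 <- RAH] \tsum[q1, q2 <- RBH] \tsum[b, a <- tau (p1 ⊗ q1)]
    K b a (p2 ∙ q2) =
  \tsum[q1, q2 <- RBH] \tsum[p1, p2 <- RAH] K q1 p1 (q2 ∙ p2).
Proof.
move=> HK; rewrite -(tsum_RHH_AB (K := fun h x => \tsum[b, a <- tau h] K b a x)) //.
transitivity (\tsum[w1, w2 <- W] \tsum[s1, s2 <- RHB]
  \tsum[q1, q2 <- RBH] \tsum[z1, z2 <- Z]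
  K (w1 * q1) (s1 ▹ z1) ((q2 ▹ z2) ⊗ (w2 * s2))).
  rewrite tsum_RHH //.
  transitivity (\tsum[s1, s2 <- RHB] \tsum[h1, h2 <- Delta s1]
    \tsum[t1, t2 <- RHA] \tsum[b, a <- tau t1]
    K (pB h1 * b) (h2 ▹ a) (t2 ⊗ s2)).
    apply: eq_tsum => s1 s2; rewrite [RHS]tsum_exch; apply: eq_tsum => t1 t2.
    by rewrite (tauM (K := fun b a => K b a _)).
  rewrite (RHB_comul1 (K := fun x y c => \tsum[t1, t2 <- RHA]
    \tsum[b, a <- tau t1] K (pB x * b) (y ▹ a) (t2 ⊗ c))) //.
  rewrite (RHB_pB (K := fun b' c => \tsum[r1, r2 <- RHB] \tsum[t1, t2 <- RHA]
    \tsum[b, a <- tau t1] K (b' * b) (r1 ▹ a) (t2 ⊗ (c * r2)))) //.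
  do 2!apply: eq_tsum => ? ?.
  rewrite (tsum_RHA (K := fun t1 t2 => \tsum[b, a <- tau t1] K _ _ _)) //.
  by rewrite (tau_RAH_Y (K := fun b a c => K (_ * b) (_ ▹ a) (c ⊗ _))).
symmetry.
transitivity (\tsum[q1, q2 <- RBH] \tsum[h1, h2 <- Delta q2]
  \tsum[s1, s2 <- RHB] \tsum[z1, z2 <- Z]
  K q1 (s1 ▹ z1) ((h1 ▹ z2) ⊗ (pB h2 * s2))).
  apply: eq_tsum => q1 q2; rewrite tsum_RAH // [RHS]tsum_exch.
  apply: eq_tsum => s1 s2; rewrite [RHS]tsum_exch; apply: eq_tsum => z1 z2.
  by rewrite (expand_mul_pure (K := K _ _)).
rewrite (RBH_comul_pB (K := fun b h c => \tsum[s1, s2 <- RHB] \tsum[z1, z2 <- Z]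
  K b (s1 ▹ z1) ((h ▹ z2) ⊗ (c * s2)))) //.
by apply: eq_tsum => w1 w2; rewrite tsum_exch.
Qed.

(** The case C = H, M = A of comul_two_factors. *)
Lemma RHA_comul1 (U : lmodType k) (K : H -> H -> A -> U) : trilin K ->
  \tsum[t1, t2 <- RHA] \tsum[h1, h2 <- Delta t1] K h1 h2 t2 =
  \tsum[r1, r2 <- RHH] \tsum[t1, t2 <- RHA] K r1 t1 (r2 ▹ t2).
Proof.
move=> HK; rewrite tsum_RHA // tsum_RHH_AB //.
rewrite (comul_two_factors bilin_actA actM RAH_comul1 Y_comul1 tau_RAH_RBH) //.
apply: eq_tsum => p1 p2; apply: eq_tsum => q1 q2; rewrite tsum_RHA //.
by do 2!apply: eq_tsum => ? ?; rewrite !actM.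
Qed.

(** RHA_comul1 is this formula with the last leg projected to A; lifting
    restores that leg. *)
Lemma RHH_comul1 (U : lmodType k) (K : H -> H -> H -> U) : trilin K ->
  \tsum[r1, r2 <- RHH] \tsum[h1, h2 <- Delta r1] K h1 h2 r2 =
  \tsum[r1, r2 <- RHH] \tsum[t1, t2 <- RHH] K r1 t1 (r2 ∙ t2).
Proof.
apply: (lift_comul1 bilin_actH actHM
  RHB_comul1 RHB_comul2 lin_comul _ RHA_comul1).
by move=> *; apply: comulM.
Qed.

(** * Comultiplication of the second leg *)

Lemma Y_comul2 (U : lmodType k) (K : B -> A -> A -> U) : trilin K ->
  \tsum[y1, y2 <- Y] \tsum[a1, a2 <- DeltaA y2] K y1 a1 a2 =
  \tsum[y1, y2 <- Y] \tsum[v1, v2 <- Y] K (y1 * v1) v2 y2.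
Proof. by move=> HK; transport3 HK C17 leaf3 leaf3. Qed.

Lemma tau_Y_W (U : lmodType k) (K : B -> B -> A -> U) : trilin K ->
  \tsum[w1, w2 <- W] \tsum[y1, y2 <- Y] \tsum[b, a <- tau (y2 ⊗ w2)]
    K (w1 * y1) b a =
  \tsum[w1, w2 <- W] \tsum[y1, y2 <- Y] K (y1 * w1) w2 y2.
Proof. by move=> HK; transport3 HK C18 leaf3 leaf3. Qed.

(** Directly from the coproduct of y2 ⊗ w2: tau is applied to a leg of Y and a
    leg of W, and tau_Y_W exchanges them. *)
Lemma RBH_comul2 (U : lmodType k) (K : B -> H -> H -> U) : trilin K ->
  \tsum[q1, q2 <- RBH] \tsum[h1, h2 <- Delta q2] K q1 h1 h2 =
  \tsum[q1, q2 <- RBH] \tsum[r1, r2 <- RBH] K (q1 * r1) r2 q2.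
Proof.
move=> HK; rewrite tsum_RBH //.
transitivity (\tsum[w1, w2 <- W] \tsum[b1, b2 <- DeltaB w2]
  \tsum[y1, y2 <- Y] \tsum[a1, a2 <- DeltaA y2] \tsum[b, a <- tau (a2 ⊗ b1)]
  K (w1 * y1) (a1 ⊗ b) (a ⊗ b2)).
  apply: eq_tsum => w1 w2; rewrite [RHS]tsum_exch; apply: eq_tsum => y1 y2.
  by rewrite comulE // tsum_exch.
rewrite (W_comul2 (K := fun w b1 b2 => \tsum[y1, y2 <- Y]
  \tsum[a1, a2 <- DeltaA y2] \tsum[b, a <- tau (a2 ⊗ b1)]
  K (w * y1) (a1 ⊗ b) (a ⊗ b2))) //.
rewrite [RHS]tsum_RBH //; apply: eq_tsum => w1 w2.
transitivity (\tsum[v1, v2 <- W] \tsum[y1, y2 <- Y] \tsum[b, a <- tau (y2 ⊗ v2)]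
  \tsum[u1, u2 <- Y] K (w1 * (v1 * y1) * u1) (u2 ⊗ b) (a ⊗ w2)).
  apply: eq_tsum => v1 v2.
  rewrite (Y_comul2 (K := fun c a1 a2 => \tsum[b, a <- tau (a2 ⊗ v2)]
    K (w1 * v1 * c) (a1 ⊗ b) (a ⊗ w2))) //.
  apply: eq_tsum => y1 y2; rewrite tsum_exch.
  by do 2!apply: eq_tsum => ? ?; rewrite !mulrA.
rewrite (tau_Y_W (K := fun c b a => \tsum[u1, u2 <- Y]
  K (w1 * c * u1) (u2 ⊗ b) (a ⊗ w2))) //.
rewrite tsum_exch; apply: eq_tsum => y1 y2; rewrite tsum_RBH //.
by do 2!apply: eq_tsum => ? ?; rewrite !mulrA.
Qed.

Lemma tau_RAH (U : lmodType k) (K : A -> B -> A -> U) : trilin K ->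
  \tsum[p1, p2 <- RAH] \tsum[b, a <- tau p2] K p1 b a =
  \tsum[t1, t2 <- RHA] \tsum[x1, x2 <- X] K (t1 ▹ x1) x2 t2.
Proof.
move=> HK; rewrite tsum_RHA // !tsum_RAH_tau //.
transitivity (\tsum[z1, z2 <- Z] \tsum[x1, x2 <- X] \tsum[u1, u2 <- X]
  \tsum[y1, y2 <- Y] \tsum[i, at_ <- tau (z1 ⊗ 1)]
  K (((at_ * x1) ⊗ y1) ▹ u1) u2 ((z2 ⊗ (i * x2)) ▹ y2)).
  by transport3 HK C15 leaf3 ltac:(rewrite tsum3_sigma2).
apply: eq_tsum => z1 z2; apply: eq_tsum => x1 x2.
rewrite [RHS]tsum_exch tsum_exch; apply: eq_tsum => y1 y2.
by rewrite tsum_exch.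
Qed.

Lemma Z_comul2 (U : lmodType k) (K : A -> A -> A -> U) : trilin K ->
  \tsum[z1, z2 <- Z] \tsum[a1, a2 <- DeltaA z2] K z1 a1 a2 =
  \tsum[t1, t2 <- RHA] \tsum[v1, v2 <- Z] K (t1 ▹ v1) v2 t2.
Proof.
move=> HK; rewrite tsum_RHA // !tsum_RAH_tau //.
transitivity (\tsum[z1, z2 <- Z] \tsum[x1, x2 <- X] \tsum[v1, v2 <- Z]
  \tsum[y1, y2 <- Y] \tsum[i, at_ <- tau (z1 ⊗ 1)]
  K (((at_ * x1) ⊗ y1) ▹ v1) v2 ((z2 ⊗ (i * x2)) ▹ y2)).
  by transport3 HK C14 leaf3 ltac:(rewrite tsum3_sigma2).
apply: eq_tsum => z1 z2; apply: eq_tsum => x1 x2.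
rewrite [RHS]tsum_exch tsum_exch; apply: eq_tsum => y1 y2.
by rewrite tsum_exch.
Qed.

(** Expand the last leg through its projections; by coassociativity tau appears
    on the first half of p2. *)
Lemma RAH_pB_comul (U : lmodType k) (K : A -> B -> H -> U) : trilin K ->
  \tsum[p1, p2 <- RAH] \tsum[h1, h2 <- Delta p2] K p1 (pB h1) h2 =
  \tsum[r1, r2 <- RHH] \tsum[x1, x2 <- X] K (r1 ▹ x1) x2 r2.
Proof.
move=> HK.
transitivity (\tsum[p1, p2 <- RAH] \tsum[h1, h2 <- Delta p2]
  \tsum[b, a <- tau h1] K p1 b (a ⊗ pB h2)).
  apply: eq_tsum => p1 p2.
  transitivity (\tsum[h1, h2 <- Delta p2] \tsum[x1, x2 <- Delta h1]
    K p1 (pB x1) (pA x2 ⊗ pB h2)).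
    rewrite (coassoc coalgH (K := fun x y z => K p1 (pB x) (pA y ⊗ pB z))) //.
    apply: eq_tsum => h1 h2.
    by rewrite (expand_pApB (K := K p1 (pB h1))).
  apply: eq_tsum => h1 h2.
  by rewrite (comul_pBpA (K := fun b a => K p1 b (a ⊗ pB h2))).
rewrite (RAH_comul_pB (K := fun c h d => \tsum[b, a <- tau h] K c b (a ⊗ d))) //.
rewrite tsum_RHH //; apply: eq_tsum => s1 s2.
rewrite (tau_RAH (K := fun c b a => K (s1 ▹ c) b (a ⊗ s2))) //.
by do 2!apply: eq_tsum => ? ?; rewrite actM.
Qed.

(** Applying pB and pA to the two halves of the second leg of
    (id ⊗ Δ) R = R_13 R_12. *)
Lemma tau_RHH (U : lmodType k) (K : H -> B -> A -> U) : trilin K ->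
  \tsum[r1, r2 <- RHH] \tsum[b, a <- tau r2] K r1 b a =
  \tsum[t1, t2 <- RHA] \tsum[s1, s2 <- RHB] K (t1 ∙ s1) s2 t2.
Proof.
move=> HK; rewrite tsum_RHH_AB //.
transitivity (\tsum[p1, p2 <- RAH] \tsum[h1, h2 <- Delta p2]
  \tsum[w1, w2 <- W] \tsum[y1, y2 <- Y]
  K (p1 ⊗ (y1 * w1)) (pB h1 * w2) (h2 ▹ y2)).
  apply: eq_tsum => p1 p2.
  transitivity (\tsum[q1, q2 <- RBH] \tsum[h1, h2 <- Delta p2]
    \tsum[b, a <- tau q2] K (p1 ⊗ q1) (pB h1 * b) (h2 ▹ a)).
    by do 1!apply: eq_tsum => ? ?; rewrite (tauM (K := K _)).
  rewrite tsum_exch; apply: eq_tsum => h1 h2; rewrite tsum_RBH //.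
  by rewrite (tau_Y_W (K := fun c b a => K (p1 ⊗ c) (pB h1 * b) (h2 ▹ a))).
rewrite (RAH_pB_comul (K := fun a b h => \tsum[w1, w2 <- W]
  \tsum[y1, y2 <- Y] K (a ⊗ (y1 * w1)) (b * w2) (h ▹ y2))) //.
rewrite tsum_RHH_AB // tsum_RHA //; apply: eq_tsum => p1 p2.
transitivity (\tsum[q1, q2 <- RBH] \tsum[y1, y2 <- Y]
  \tsum[x1, x2 <- X] \tsum[w1, w2 <- W]
  K ((p1 * ((1 ⊗ q1) ▹ x1)) ⊗ (y1 * w1)) (x2 * w2) (p2 ▹ q2 ▹ y2)).
  apply: eq_tsum => q1 q2; rewrite [RHS]tsum_exch; apply: eq_tsum => x1 x2.
  rewrite tsum_exch; do 2!apply: eq_tsum => ? ?.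
  by rewrite actM act_pure.
rewrite -(Y_comul1 (K := fun b c a => \tsum[x1, x2 <- X] \tsum[w1, w2 <- W]
  K ((p1 * ((1 ⊗ b) ▹ x1)) ⊗ (c * w1)) (x2 * w2) (p2 ▹ a))) //.
apply: eq_tsum => y1 y2; rewrite tsum_RHB // tsum_exch; apply: eq_tsum => x1 x2.
rewrite tsum_exch; apply: eq_tsum => w1 w2.
by rewrite mul_pure_pure (lin_tsumE _ _ (trilin1 _ _ HK)).
Qed.

(** In the coproduct of z2 ⊗ s2 a copy of RHH builds up from a copy of RHA,
    created by the coproduct of z2, and one of RHB, created by that of s2;
    tau_RHH then exchanges the two. *)
Lemma RAH_comul2 (U : lmodType k) (K : A -> H -> H -> U) : trilin K ->
  \tsum[p1, p2 <- RAH] \tsum[h1, h2 <- Delta p2] K p1 h1 h2 =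
  \tsum[r1, r2 <- RHH] \tsum[p1, p2 <- RAH] K (r1 ▹ p1) p2 r2.
Proof.
move=> HK; rewrite tsum_RAH //.
transitivity (\tsum[s1, s2 <- RHB] \tsum[b1, b2 <- DeltaB s2]
  \tsum[z1, z2 <- Z] \tsum[a1, a2 <- DeltaA z2] \tsum[b, a <- tau (a2 ⊗ b1)]
  K (s1 ▹ z1) (a1 ⊗ b) (a ⊗ b2)).
  apply: eq_tsum => s1 s2; rewrite [RHS]tsum_exch; apply: eq_tsum => z1 z2.
  by rewrite comulE // tsum_exch.
rewrite (RHB_comul2 (K := fun h b1 b2 => \tsum[z1, z2 <- Z]
  \tsum[a1, a2 <- DeltaA z2] \tsum[b, a <- tau (a2 ⊗ b1)]
  K (h ▹ z1) (a1 ⊗ b) (a ⊗ b2))) //.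
rewrite tsum_RHH //; apply: eq_tsum => s1 s2.
transitivity (\tsum[r1, r2 <- RHH] \tsum[b, a <- tau r2]
  \tsum[z1, z2 <- Z] K (s1 ▹ r1 ▹ z1) (z2 ⊗ b) (a ⊗ s2)).
  rewrite tsum_RHH //; apply: eq_tsum => r1 r2.
  rewrite (Z_comul2 (K := fun a1 a2 a3 => \tsum[b, a <- tau (a3 ⊗ r2)]
    K ((s1 ∙ r1) ▹ a1) (a2 ⊗ b) (a ⊗ s2))) //.
  apply: eq_tsum => t1 t2; rewrite tsum_exch.
  by do 2!apply: eq_tsum => ? ?; rewrite !actM.
rewrite (tau_RHH (K := fun h b a => \tsum[z1, z2 <- Z]
  K (s1 ▹ h ▹ z1) (z2 ⊗ b) (a ⊗ s2))) //.
apply: eq_tsum => t1 t2; rewrite tsum_RAH //.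
by do 2!apply: eq_tsum => ? ?; rewrite !actM.
Qed.

(** Multiply the coproducts of the second legs of RAH and RBH; the action of
    RHH on p1 is absorbed by the coproduct of q1. *)
Lemma RHH_comul2 (U : lmodType k) (K : H -> H -> H -> U) : trilin K ->
  \tsum[r1, r2 <- RHH] \tsum[h1, h2 <- Delta r2] K r1 h1 h2 =
  \tsum[r1, r2 <- RHH] \tsum[t1, t2 <- RHH] K (r1 ∙ t1) t2 r2.
Proof.
move=> HK; rewrite tsum_RHH_AB //.
transitivity (\tsum[p1, p2 <- RAH] \tsum[h1, h2 <- Delta p2]
  \tsum[q1, q2 <- RBH] \tsum[r1, r2 <- RBH]
  K (p1 ⊗ (q1 * r1)) (h1 ∙ r2) (h2 ∙ q2)).
  apply: eq_tsum => p1 p2.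
  transitivity (\tsum[q1, q2 <- RBH] \tsum[x1, x2 <- Delta q2]
    \tsum[h1, h2 <- Delta p2] K (p1 ⊗ q1) (h1 ∙ x1) (h2 ∙ x2)).
    apply: eq_tsum => q1 q2; rewrite comulM //.
    by rewrite [RHS]tsum_exch.
  rewrite (RBH_comul2 (K := fun b x y => \tsum[h1, h2 <- Delta p2]
    K (p1 ⊗ b) (h1 ∙ x) (h2 ∙ y))) //.
  rewrite [RHS]tsum_exch; apply: eq_tsum => q1 q2.
  by rewrite tsum_exch.
rewrite (RAH_comul2 (K := fun a x y => \tsum[q1, q2 <- RBH] \tsum[r1, r2 <- RBH]
  K (a ⊗ (q1 * r1)) (x ∙ r2) (y ∙ q2))) //.
rewrite tsum_RHH_AB // [RHS]tsum_RHH_AB //; apply: eq_tsum => p1 p2.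
transitivity (\tsum[q1, q2 <- RBH] \tsum[u1, u2 <- RBH] \tsum[v1, v2 <- RAH]
  \tsum[r1, r2 <- RBH]
  K ((p1 * ((1 ⊗ q1) ▹ v1)) ⊗ (u1 * r1)) (v2 ∙ r2) (p2 ∙ (q2 ∙ u2))).
  apply: eq_tsum => q1 q2; rewrite tsum_exch; apply: eq_tsum => u1 u2.
  do 2!apply: eq_tsum => ? ?.
  by rewrite smash_mulA act_pure.
(* The copy of RBH that acts on v1 and the one that multiplies r1 merge into
   the two halves of a single coproduct. *)
rewrite -(RBH_comul1 (K := fun b c h => \tsum[v1, v2 <- RAH] \tsum[r1, r2 <- RBH]
  K ((p1 * ((1 ⊗ b) ▹ v1)) ⊗ (c * r1)) (v2 ∙ r2) (p2 ∙ h))) //.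
apply: eq_tsum => q1 q2; rewrite tsum_RHH_AB // tsum_exch; apply: eq_tsum => v1 v2.
rewrite tsum_exch; apply: eq_tsum => r1 r2.
by rewrite mul_pure_pure (lin_tsumE _ _ (trilin1 _ _ HK)).
Qed.

(** * Counits *)

(** A scalar is compared through its action on 1 in k^o, a vector space to
    which tens_lin_ext applies. *)
Lemma epsA_pA h : epsA (pA h) = eps h.
Proof.
suff E : (fun h => epsA (pA h) *: (1 : k^o)) =1 (fun h => eps h *: (1 : k^o)).
  by have := E h; rewrite /GRing.scale /= !mulr1.
by apply: tens_lin_ext => // a b; rewrite pAE epsE linearZ /= mulrC.
Qed.

Lemma epsM x y : eps (x ∙ y) = eps x * eps y.
Proof. by case: bialgH => _ _ _ [-> _]. Qed.

Lemma epsA_act h a : epsA (h ▹ a) = eps h * epsA a.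
Proof. by rewrite epsA_pA epsM epsE epsB1 mulr1. Qed.

Lemma RHB_counitl (U : lmodType k) (F : B -> U) : lin F ->
  \tsum[s1, s2 <- RHB] eps s1 *: F s2 = F 1.
Proof.
move=> HF; rewrite tsum_RHB // -(norml normX HF); apply: eq_tsum => x1 x2.
rewrite -[in RHS](mulr1 x2) -(norml (F := fun b => F (x2 * b)) normW) //.
by rewrite tsumZ; apply: eq_tsum => w1 w2; rewrite epsE scalerA.
Qed.

Lemma RHB_counitr (U : lmodType k) (F : H -> U) : lin F ->
  \tsum[s1, s2 <- RHB] epsB s2 *: F s1 = F (1 ⊗ 1).
Proof.
move=> HF; rewrite tsum_RHB // -(normr (F := fun a => F (a ⊗ 1)) normX) //.
apply: eq_tsum => x1 x2.
rewrite -(normr (F := fun b => F (x1 ⊗ b)) normW) //.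
by rewrite tsumZ; apply: eq_tsum => w1 w2; rewrite epsBM scalerA.
Qed.

Lemma RAH_counitl (U : lmodType k) (F : H -> U) : lin F ->
  \tsum[p1, p2 <- RAH] epsA p1 *: F p2 = F (1 ⊗ 1).
Proof.
move=> HF; rewrite tsum_RAH // -(RHB_counitl (F := fun b => F (1 ⊗ b))) //.
apply: eq_tsum => s1 s2.
rewrite -(norml (F := fun a => F (a ⊗ s2)) normZ) //.
by rewrite tsumZ; apply: eq_tsum => z1 z2; rewrite epsA_act scalerA.
Qed.

Lemma RAH_counitr (U : lmodType k) (F : A -> U) : lin F ->
  \tsum[p1, p2 <- RAH] eps p2 *: F p1 = F 1.
Proof.
move=> HF; rewrite tsum_RAH // -[1 in RHS]act1.
rewrite -(RHB_counitr (F := fun h => F (h ▹ 1))) //.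
apply: eq_tsum => s1 s2.
rewrite -(normr (F := fun a => F (s1 ▹ a)) normZ) //.
by rewrite tsumZ; apply: eq_tsum => z1 z2; rewrite epsE scalerA mulrC.
Qed.

Lemma RBH_counitl (U : lmodType k) (F : H -> U) : lin F ->
  \tsum[q1, q2 <- RBH] epsB q1 *: F q2 = F (1 ⊗ 1).
Proof.
move=> HF; rewrite tsum_RBH // -(norml (F := fun b => F (1 ⊗ b)) normW) //.
apply: eq_tsum => w1 w2.
rewrite -(norml (F := fun a => F (a ⊗ w2)) normY) //.
by rewrite tsumZ; apply: eq_tsum => y1 y2; rewrite epsBM scalerA.
Qed.

(** By normalization of Z and X. *)
Lemma RHH_pB (U : lmodType k) (K : B -> H -> U) : bilin K ->
  \tsum[r1, r2 <- RHH] K (pB r1) r2 = tsum RBH K.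
Proof.
move=> HK; rewrite (tsum_RHH_AB (K := fun h => K (pB h))) //.
rewrite tsum_exch; apply: eq_tsum => q1 q2.
rewrite -[in RHS](smash_mul1l q2) -(RAH_counitl (F := fun h => K q1 (h ∙ q2))) //.
by apply: eq_tsum => p1 p2; rewrite pBE (linZ _ _ (bilin1 _ HK)).
Qed.

Lemma RHH_counitl : \tsum[r1, r2 <- RHH] eps r1 *: r2 = 1 ⊗ 1.
Proof.
rewrite tsum_RHH_AB // -[RHS]smash_mul1l.
rewrite -(RAH_counitl (F := fun h => h ∙ (1 ⊗ 1))) //; apply: eq_tsum => p1 p2.
rewrite -(RBH_counitl (F := fun h => p2 ∙ h)) //.
by rewrite tsumZ; apply: eq_tsum => q1 q2; rewrite epsE scalerA.
Qed.

Lemma RHA_counitr (U : lmodType k) (F : H -> U) : lin F ->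
  \tsum[t1, t2 <- RHA] epsA t2 *: F t1 = F (1 ⊗ 1).
Proof.
move=> HF; rewrite tsum_RHA // -(RAH_counitr (F := fun a => F (a ⊗ 1))) //.
apply: eq_tsum => p1 p2.
rewrite -(normr (F := fun b => F (p1 ⊗ b)) normY) //.
by rewrite tsumZ; apply: eq_tsum => y1 y2; rewrite epsA_act scalerA.
Qed.

Lemma RHH_counitr : \tsum[r1, r2 <- RHH] eps r2 *: r1 = 1 ⊗ 1.
Proof.
rewrite tsum_RHH // -[RHS]smash_mul1l.
rewrite -(RHB_counitr (F := fun h => h ∙ (1 ⊗ 1))) //; apply: eq_tsum => s1 s2.
rewrite -(RHA_counitr (F := fun h => s1 ∙ h)) //.
by rewrite tsumZ; apply: eq_tsum => t1 t2; rewrite epsE scalerA mulrC.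
Qed.

(** * Intertwining the comultiplication with its opposite *)

Lemma braid_BB_iB (U : lmodType k) (K : B -> B -> U) b : bilin K ->
  \tsum[w1, w2 <- W] \tsum[b1, b2 <- DeltaB b] K (w1 * b1) (w2 * b2) =
  \tsum[w1, w2 <- W] \tsum[b1, b2 <- DeltaB b] K (b2 * w1) (b1 * w2).
Proof. by move=> HK; transport2 HK (C7 b) leaf2 leaf2. Qed.

(** The rules braid_MN express R Δ(h) = Δ^cop(h) R after projecting its first
    leg to M and its second leg to N. *)
Lemma braid_BB (U : lmodType k) (K : B -> B -> U) h : bilin K ->
  \tsum[w1, w2 <- W] \tsum[h1, h2 <- Delta h] K (w1 * pB h1) (w2 * pB h2) =
  \tsum[h1, h2 <- Delta h] \tsum[w1, w2 <- W] K (pB h2 * w1) (pB h1 * w2).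
Proof.
move=> HK; rewrite [RHS]tsum_exch.
transitivity (\tsum[w1, w2 <- W] \tsum[b1, b2 <- DeltaB (pB h)]
  K (w1 * b1) (w2 * b2)).
  apply: eq_tsum => w1 w2.
  by rewrite (comul_pBpB (K := fun b c => K (w1 * b) (w2 * c))).
rewrite braid_BB_iB //; apply: eq_tsum => w1 w2.
by rewrite (comul_pBpB (K := fun b c => K (c * w1) (b * w2))).
Qed.

Lemma braid_AB_iB (U : lmodType k) (K : A -> B -> U) b : bilin K ->
  \tsum[x1, x2 <- X] K x1 (x2 * b) =
  \tsum[x1, x2 <- X] \tsum[b1, b2 <- DeltaB b] \tsum[bt, j <- tau (1 ⊗ b1)]
    K (j * ((1 ⊗ b2) ▹ x1)) (bt * x2).
Proof.
move=> HK; transport2 HK (C5 b) leaf2 ltac:(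
  rewrite tsum_tsum // -(sigma_act_mul (F := fun a => K a _)) //;
  apply: eq_tsum => ? ?; leaf2).
Qed.

(** Any h is a sum of products (a ⊗ 1) (1 ⊗ b), and the rules for a and for b
    are given; on the left the two coproducts collapse to a ⊗ b itself. *)
Lemma braid_AB (U : lmodType k) (K : A -> B -> U) h : bilin K ->
  \tsum[s1, s2 <- RHB] \tsum[h1, h2 <- Delta h] K (s1 ▹ pA h1) (s2 * pB h2) =
  \tsum[h1, h2 <- Delta h] \tsum[x1, x2 <- X] K (h2 ▹ x1) (pB h1 * x2).
Proof.
move=> HK; move: h; apply: tens_lin_ext => // a b.
transitivity (\tsum[s1, s2 <- RHB] K (s1 ▹ a) (s2 * b)).
  apply: eq_tsum => s1 s2.
  by rewrite (comul_pApB (K := fun a b => K (s1 ▹ a) (s2 * b))) // tsumE.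
rewrite (braid_AB_iA (K := fun a c => K a (c * b))) //.
transitivity (\tsum[x1, x2 <- X] \tsum[i, at_ <- tau (a ⊗ 1)]
  K (at_ * x1) (i * (x2 * b))).
  by do 2!apply: eq_tsum => ? ?; rewrite mulrA.
rewrite (braid_AB_iB (K := fun u v => \tsum[i, at_ <- tau (a ⊗ 1)]
  K (at_ * u) (i * v))) //.
rewrite (comul_pB_pure_l (K := fun b h =>
  \tsum[x1, x2 <- X] K (h ▹ x1) (b * x2))) //.
rewrite tsum_exch; apply: eq_tsum => b1 b2.
rewrite [RHS]tsum_exch; apply: eq_tsum => x1 x2.
rewrite (tau_split (K := fun bt at_ => K ((at_ ⊗ b2) ▹ x1) (bt * x2))) //.
rewrite tsum_exch; do 2!apply: eq_tsum => ? ?.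
by rewrite act_pure !mulrA.
Qed.

Lemma braid_BA_iA (U : lmodType k) (K : B -> A -> U) a : bilin K ->
  \tsum[w1, w2 <- W] \tsum[y1, y2 <- Y] \tsum[i, at_ <- tau (a ⊗ 1)]
    K (w1 * y1 * i) (y2 * ((1 ⊗ w2) ▹ at_)) =
  \tsum[y1, y2 <- Y] K y1 (a * y2).
Proof.
by move=> HK; transport2 HK (C3 a) ltac:(rewrite tsum_sigma) leaf2.
Qed.

Lemma braid_BA_iB (U : lmodType k) (K : B -> A -> U) b : bilin K ->
  \tsum[w1, w2 <- W] \tsum[y1, y2 <- Y] \tsum[bt, j <- tau (1 ⊗ b)]
    K (w1 * y1 * bt) (y2 * ((1 ⊗ w2) ▹ j)) =
  \tsum[y1, y2 <- Y] \tsum[b1, b2 <- DeltaB b] K (b2 * y1) ((1 ⊗ b1) ▹ y2).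
Proof.
move=> HK; transitivity (\tsum[y1, y2 <- Y]
  \tsum[as_, bs <- sigma (b ⊗ y2)] K (bs * y1) as_).
  by transport2 HK (C6 b) ltac:(rewrite tsum_sigma) leaf2.
apply: eq_tsum => y1 y2.
by rewrite (sigmaE (F := fun a c => K (c * y1) a)).
Qed.

(** The action on a product a' a'' coming from the two parts of h is split by the
    B-module algebra structure of A, which duplicates W; one copy serves the
    rule for a, the other the rule for b. *)
Lemma braid_BA (U : lmodType k) (K : B -> A -> U) h : bilin K ->
  \tsum[q1, q2 <- RBH] \tsum[h1, h2 <- Delta h] K (q1 * pB h1) (q2 ▹ pA h2) =
  \tsum[h1, h2 <- Delta h] \tsum[y1, y2 <- Y] K (pB h2 * y1) (h1 ▹ y2).
Proof.
move=> HK; move: h; apply: tens_lin_ext => // a b.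
rewrite (comul_pB_pure (K := fun h b =>
  \tsum[y1, y2 <- Y] K (b * y1) (h ▹ y2))) //.
transitivity (\tsum[q1, q2 <- RBH] \tsum[i, at_ <- tau (a ⊗ 1)]
  \tsum[bt, j <- tau (1 ⊗ b)] K (q1 * (i * bt)) (q2 ▹ (at_ * j))).
  apply: eq_tsum => q1 q2.
  rewrite (comul_pBpA (K := fun b a => K (q1 * b) (q2 ▹ a))) //.
  by rewrite (tau_split (K := fun b a => K (q1 * b) (q2 ▹ a))).
rewrite tsum_RBH //.
transitivity (\tsum[w1, w2 <- W] \tsum[b1, b2 <- DeltaB w2]
  \tsum[y1, y2 <- Y] \tsum[i, at_ <- tau (a ⊗ 1)] \tsum[bt, j <- tau (1 ⊗ b)]
    K (w1 * y1 * (i * bt)) (y2 * (((1 ⊗ b1) ▹ at_) * ((1 ⊗ b2) ▹ j)))).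
  apply: eq_tsum => w1 w2; rewrite [RHS]tsum_exch; apply: eq_tsum => y1 y2.
  rewrite [RHS]tsum_exch; apply: eq_tsum => i at_.
  rewrite [RHS]tsum_exch; apply: eq_tsum => bt j.
  rewrite act_pure act_mulA.
  rewrite (comul_pB_pure (K := fun h b => (h ▹ at_) * ((1 ⊗ b) ▹ j))) //.
  by rewrite (lin_tsumE _ _ (lin_comp (bilin2 _ HK) (lin_mulr _))).
rewrite (W_comul2 (K := fun w b1 b2 => \tsum[y1, y2 <- Y]
  \tsum[i, at_ <- tau (a ⊗ 1)] \tsum[bt, j <- tau (1 ⊗ b)]
    K (w * y1 * (i * bt)) (y2 * (((1 ⊗ b1) ▹ at_) * ((1 ⊗ b2) ▹ j))))) //.
transitivity (\tsum[w1, w2 <- W] \tsum[y1, y2 <- Y]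
  \tsum[bt, j <- tau (1 ⊗ b)]
    K (w1 * y1 * bt) (a * (y2 * ((1 ⊗ w2) ▹ j)))).
  apply: eq_tsum => w1 w2.
  transitivity (\tsum[y1, y2 <- Y] \tsum[bt, j <- tau (1 ⊗ b)]
    K (w1 * y1 * bt) (a * y2 * ((1 ⊗ w2) ▹ j))); last first.
    by do 2!apply: eq_tsum => ? ?; rewrite !mulrA.
  rewrite -(braid_BA_iA (K := fun c d => \tsum[bt, j <- tau (1 ⊗ b)]
    K (w1 * c * bt) (d * ((1 ⊗ w2) ▹ j)))) //.
  by do 4!apply: eq_tsum => ? ?; rewrite !mulrA.
rewrite (braid_BA_iB (K := fun c d => K c (a * d))) // tsum_exch.
by do 2!apply: eq_tsum => ? ?; rewrite act_pure.
Qed.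

Lemma braid_AA_iA (U : lmodType k) (K : A -> A -> U) a : bilin K ->
  \tsum[r1, r2 <- RHH] \tsum[a1, a2 <- DeltaA a] K (r1 ▹ a1) (r2 ▹ a2) =
  \tsum[z1, z2 <- Z] \tsum[a1, a2 <- DeltaA a] \tsum[i, at_ <- tau (a2 ⊗ 1)]
    K (at_ * z1) (a1 * ((1 ⊗ i) ▹ z2)).
Proof.
move=> HK; rewrite -tsum_RHH_expanded //.
transitivity (\tsum[z1, z2 <- Z] \tsum[u1, u2 <- X] \tsum[x1, x2 <- X]
  \tsum[w1, w2 <- W] \tsum[y1, y2 <- Y] \tsum[a1, a2 <- DeltaA a]
  \tsum[i1, z1t1 <- tau (z1 ⊗ 1)]
  \tsum[i2, z1t12 <- tau (z1t1 ⊗ 1)]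
  \tsum[i3, u1t3 <- tau (u1 ⊗ 1)]
  \tsum[y2s1, u2s1 <- sigma (u2 ⊗ y2)]
  \tsum[y2s12, i1s2 <- sigma (i1 ⊗ y2s1)]
    K (((z1t12 * u1t3 * x1) ⊗ (w1 * y1)) ▹ a1)
      (((epsB (i1s2 * u2s1) *: (z2 * y2s12)) ⊗ (i2 * i3 * x2 * w2)) ▹ a2)).
  do 5!apply: eq_tsum => ? ?; rewrite [RHS]tsum_exch; apply: eq_tsum => i1 ?.
  rewrite [RHS]tsum_exch; apply: eq_tsum => ? ?.
  rewrite [RHS]tsum_exch; apply: eq_tsum => ? ?.
  rewrite [RHS]tsum_exch; apply: eq_tsum => ? ?.
  by rewrite [RHS]tsum_exch.
transport2 HK (C1 a) ltac:(idtac) ltac:(by rewrite tsum_sigma).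
rewrite tsum_tsum // act_pure -(sigma_act_mul (F := fun a => K a _)) //.
apply: eq_tsum => a1s3 w1y1s3.
rewrite tsum_tsum // act_pure -(sigma_act_mul (F := K _)) //.
apply: eq_tsum => a2s4 ps4; rewrite tsumE //; congr (K _ _).
by rewrite -scalerAl !scalerA mulrC.
Qed.

Lemma braid_AA_iB (U : lmodType k) (K : A -> A -> U) b : bilin K ->
  \tsum[z1, z2 <- Z] \tsum[b1, b2 <- DeltaB b] \tsum[bt, j <- tau (1 ⊗ b1)]
    K (j * ((1 ⊗ b2) ▹ z1)) ((1 ⊗ bt) ▹ z2) =
  epsB b *: \tsum[z1, z2 <- Z] K z1 z2.
Proof.
move=> HK; rewrite tsumZ; symmetry.
transport2 HK (C4 b) ltac:(by rewrite tsumE // (linZ _ _ (bilin2 _ HK)))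
  ltac:(idtac).
rewrite tsum_tsum // -(sigma_act (F := fun a => K (_ * a) _)) //.
apply: eq_tsum => z1s1 b2s1; rewrite tsum_tsum // -(sigma_act (F := K _)) //.
rewrite tsumZ; apply: eq_tsum => z2s2 b1ts2.
by rewrite tsumE // !(linZ _ _ (bilin2 _ HK)) !scalerA mulrC.
Qed.

Lemma braid_AA_iB_comul (U : lmodType k) (K : A -> A -> U) b : bilin K ->
  \tsum[z1, z2 <- Z] \tsum[h1, h2 <- Delta (1 ⊗ b)] K (h2 ▹ z1) (h1 ▹ z2) =
  epsB b *: \tsum[z1, z2 <- Z] K z1 z2.
Proof.
move=> HK; rewrite -braid_AA_iB //; apply: eq_tsum => z1 z2.
rewrite (comul_iB (K := fun h1 h2 => K (h2 ▹ z1) (h1 ▹ z2))) //.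
by do 2!apply: eq_tsum => ? ?; rewrite [(_ ⊗ _) ▹ z1]act_pure.
Qed.

(** Both sides are multiplied by epsB b when h is replaced by h (1 ⊗ b), so
    the rule for a ⊗ 1 suffices. *)
Lemma braid_AA (U : lmodType k) (K : A -> A -> U) h : bilin K ->
  \tsum[r1, r2 <- RHH] \tsum[h1, h2 <- Delta h]
    K (r1 ▹ pA h1) (r2 ▹ pA h2) =
  \tsum[h1, h2 <- Delta h] \tsum[z1, z2 <- Z] K (h2 ▹ z1) (h1 ▹ z2).
Proof.
move=> HK; move: h; apply: tens_lin_ext => // a b.
transitivity (epsB b *: \tsum[r1, r2 <- RHH] \tsum[a1, a2 <- DeltaA a]
  K (r1 ▹ a1) (r2 ▹ a2)).
  rewrite tsumZ; apply: eq_tsum => r1 r2.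
  rewrite (comul_pApA (K := fun a1 a2 => K (r1 ▹ a1) (r2 ▹ a2))) //.
  by rewrite pAE linearZ /= (linZ _ _ (lin_tsum _)).
rewrite braid_AA_iA // -(iAiB a b) (comulM (K := fun h1 h2 =>
  \tsum[z1, z2 <- Z] K (h2 ▹ z1) (h1 ▹ z2))) //.
transitivity (\tsum[h1, h2 <- Delta (a ⊗ 1)]
  (epsB b *: \tsum[z1, z2 <- Z] K (h2 ▹ z1) (h1 ▹ z2))).
  rewrite -tsumZ; congr (_ *: _).
  rewrite [RHS]tsum_exch.
  apply: eq_tsum => z1 z2.
  rewrite (comul_iA (K := fun h1 h2 => K (h2 ▹ z1) (h1 ▹ z2))) //.
  by do 2!apply: eq_tsum => ? ?; rewrite act_iA [(_ ⊗ _) ▹ z2]act_pure.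
apply: eq_tsum => h1 h2.
rewrite -(braid_AA_iB_comul b (K := fun c d => K (h2 ▹ c) (h1 ▹ d))) // tsum_exch.
by do 2!apply: eq_tsum => ? ?; rewrite !actM.
Qed.

(** Expand the first leg s1 h1 through its projections: the part in A follows
    braid_AB and the part in B follows braid_BB. *)
Lemma braid_HB (U : lmodType k) (K : H -> B -> U) h : bilin K ->
  \tsum[s1, s2 <- RHB] \tsum[h1, h2 <- Delta h] K (s1 ∙ h1) (s2 * pB h2) =
  \tsum[h1, h2 <- Delta h] \tsum[s1, s2 <- RHB] K (h2 ∙ s1) (pB h1 * s2).
Proof.
move=> HK; rewrite tsum_exch.
transitivity (\tsum[h1, h2 <- Delta h] \tsum[h11, h12 <- Delta h1]
  \tsum[s1, s2 <- RHB] \tsum[w1, w2 <- W]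
  K ((s1 ▹ pA h11) ⊗ (w1 * pB h12)) (s2 * w2 * pB h2)).
  apply: eq_tsum => h1 h2.
  transitivity (\tsum[s1, s2 <- RHB] \tsum[x1, x2 <- Delta s1]
    \tsum[h11, h12 <- Delta h1]
    K ((x1 ▹ pA h11) ⊗ (pB x2 * pB h12)) (s2 * pB h2)).
    apply: eq_tsum => s1 s2.
    rewrite (expand_pApB (K := fun h => K h (s2 * pB h2))) //.
    rewrite (comulM (K := fun x y => K (pA x ⊗ pB y) (s2 * pB h2))) //.
    by do 2!apply: eq_tsum => ? ?; rewrite pAM pBM.
  rewrite (RHB_comul1_pB (K := fun x b c => \tsum[h11, h12 <- Delta h1]
    K ((x ▹ pA h11) ⊗ (b * pB h12)) (c * pB h2))) //.
  rewrite [RHS]tsum_exch; apply: eq_tsum => s1 s2.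
  by rewrite tsum_exch.
rewrite (coassoc coalgH (K := fun h1 h2 h3 => \tsum[s1, s2 <- RHB]
  \tsum[w1, w2 <- W]
  K ((s1 ▹ pA h1) ⊗ (w1 * pB h2)) (s2 * w2 * pB h3))) //.
transitivity (\tsum[h1, h2 <- Delta h] \tsum[h21, h22 <- Delta h2]
  \tsum[s1, s2 <- RHB] \tsum[w1, w2 <- W]
  K ((s1 ▹ pA h1) ⊗ (pB h22 * w1)) (s2 * (pB h21 * w2))).
  apply: eq_tsum => h1 h2.
  rewrite tsum_exch [RHS]tsum_exch; apply: eq_tsum => s1 s2.
  rewrite -(braid_BB _ (K := fun b c => K ((s1 ▹ pA h1) ⊗ b) (s2 * c))) //.
  by rewrite tsum_exch; do 2!apply: eq_tsum => ? ?; rewrite mulrA.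
rewrite -(coassoc coalgH (K := fun h1 h2 h3 => \tsum[s1, s2 <- RHB]
  \tsum[w1, w2 <- W]
  K ((s1 ▹ pA h1) ⊗ (pB h3 * w1)) (s2 * (pB h2 * w2)))) //.
transitivity (\tsum[h1, h2 <- Delta h] \tsum[h11, h12 <- Delta h1]
  \tsum[x1, x2 <- X] \tsum[w1, w2 <- W]
  K ((h12 ▹ x1) ⊗ (pB h2 * w1)) (pB h11 * x2 * w2)).
  apply: eq_tsum => h1 h2; rewrite tsum_exch.
  rewrite -(braid_AB _ (K := fun a b => \tsum[w1, w2 <- W]
    K (a ⊗ (pB h2 * w1)) (b * w2))) //.
  by do 3!apply: eq_tsum => ? ?; rewrite mulrA.
rewrite (coassoc coalgH (K := fun h1 h2 h3 => \tsum[x1, x2 <- X]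
  \tsum[w1, w2 <- W]
  K ((h2 ▹ x1) ⊗ (pB h3 * w1)) (pB h1 * x2 * w2))) //.
apply: eq_tsum => h1 h2; rewrite tsum_RHB // tsum_exch; apply: eq_tsum => x1 x2.
rewrite tsum_exch; apply: eq_tsum => w1 w2.
by rewrite (expand_mul_pure (K := fun h => K h _)) // mulrA.
Qed.

Lemma braid_AH (U : lmodType k) (K : A -> H -> U) h : bilin K ->
  \tsum[r1, r2 <- RHH] \tsum[h1, h2 <- Delta h] K (r1 ▹ pA h1) (r2 ∙ h2) =
  \tsum[h1, h2 <- Delta h] \tsum[p1, p2 <- RAH] K (h2 ▹ p1) (h1 ∙ p2).
Proof.
exact: (lift_braid bilin_actA actM RHH_comul_pB braid_HB lin_pA braid_AA).
Qed.

(** Expand the first leg r1 h1 through its projections.  The coproduct of r1 is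
    RHH_comul1, which supplies the copy of RBH that braid_BA needs. *)
Lemma braid_HA (U : lmodType k) (K : H -> A -> U) h : bilin K ->
  \tsum[r1, r2 <- RHH] \tsum[h1, h2 <- Delta h] K (r1 ∙ h1) (r2 ▹ pA h2) =
  \tsum[h1, h2 <- Delta h] \tsum[t1, t2 <- RHA] K (h2 ∙ t1) (h1 ▹ t2).
Proof.
move=> HK; rewrite tsum_exch.
transitivity (\tsum[h1, h2 <- Delta h] \tsum[h11, h12 <- Delta h1]
  \tsum[r1, r2 <- RHH] \tsum[q1, q2 <- RBH]
  K ((r1 ▹ pA h11) ⊗ (q1 * pB h12)) (r2 ▹ q2 ▹ pA h2)).
  apply: eq_tsum => h1 h2.
  transitivity (\tsum[r1, r2 <- RHH] \tsum[x1, x2 <- Delta r1]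
    \tsum[h11, h12 <- Delta h1]
    K ((x1 ▹ pA h11) ⊗ (pB x2 * pB h12)) (r2 ▹ pA h2)).
    apply: eq_tsum => r1 r2.
    rewrite (expand_pApB (K := fun h => K h (r2 ▹ pA h2))) //.
    rewrite (comulM (K := fun x y => K (pA x ⊗ pB y) (r2 ▹ pA h2))) //.
    by do 2!apply: eq_tsum => ? ?; rewrite pAM pBM.
  rewrite (RHH_comul1 (K := fun x y z => \tsum[h11, h12 <- Delta h1]
    K ((x ▹ pA h11) ⊗ (pB y * pB h12)) (z ▹ pA h2))) //.
  rewrite [RHS]tsum_exch; apply: eq_tsum => r1 r2.
  rewrite (RHH_pB (K := fun b y => \tsum[h11, h12 <- Delta h1]
    K ((r1 ▹ pA h11) ⊗ (b * pB h12)) ((r2 ∙ y) ▹ pA h2))) //.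
  by rewrite tsum_exch; do 2!apply: eq_tsum => ? ?; rewrite actM.
rewrite (coassoc coalgH (K := fun h1 h2 h3 => \tsum[r1, r2 <- RHH]
  \tsum[q1, q2 <- RBH]
  K ((r1 ▹ pA h1) ⊗ (q1 * pB h2)) (r2 ▹ q2 ▹ pA h3))) //.
transitivity (\tsum[h1, h2 <- Delta h] \tsum[h21, h22 <- Delta h2]
  \tsum[r1, r2 <- RHH] \tsum[y1, y2 <- Y]
  K ((r1 ▹ pA h1) ⊗ (pB h22 * y1)) ((r2 ∙ h21) ▹ y2)).
  apply: eq_tsum => h1 h2.
  rewrite tsum_exch [RHS]tsum_exch; apply: eq_tsum => r1 r2.
  rewrite tsum_exch (braid_BA _ (K := fun b a =>
    K ((r1 ▹ pA h1) ⊗ b) (r2 ▹ a))) //.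
  by do 2!apply: eq_tsum => ? ?; rewrite actM.
rewrite -(coassoc coalgH (K := fun h1 h2 h3 => \tsum[r1, r2 <- RHH]
  \tsum[y1, y2 <- Y]
  K ((r1 ▹ pA h1) ⊗ (pB h3 * y1)) ((r2 ∙ h2) ▹ y2))) //.
transitivity (\tsum[h1, h2 <- Delta h] \tsum[h11, h12 <- Delta h1]
  \tsum[p1, p2 <- RAH] \tsum[y1, y2 <- Y]
  K ((h12 ▹ p1) ⊗ (pB h2 * y1)) ((h11 ∙ p2) ▹ y2)).
  apply: eq_tsum => h1 h2; rewrite tsum_exch.
  by rewrite (braid_AH _ (K := fun a x => \tsum[y1, y2 <- Y]
    K (a ⊗ (pB h2 * y1)) (x ▹ y2))).
rewrite (coassoc coalgH (K := fun h1 h2 h3 => \tsum[p1, p2 <- RAH]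
  \tsum[y1, y2 <- Y]
  K ((h2 ▹ p1) ⊗ (pB h3 * y1)) ((h1 ∙ p2) ▹ y2))) //.
apply: eq_tsum => h1 h2; rewrite tsum_RHA // tsum_exch; apply: eq_tsum => p1 p2.
rewrite tsum_exch; apply: eq_tsum => y1 y2.
by rewrite (expand_mul_pure (K := fun h => K h _)) // actM.
Qed.

Lemma braid_HH (U : lmodType k) (K : H -> H -> U) h : bilin K ->
  \tsum[r1, r2 <- RHH] \tsum[h1, h2 <- Delta h] K (r1 ∙ h1) (r2 ∙ h2) =
  \tsum[h1, h2 <- Delta h] \tsum[r1, r2 <- RHH] K (h2 ∙ r1) (h1 ∙ r2).
Proof.
exact: (lift_braid bilin_actH actHM
  RHH_comul_pB braid_HB (@lin_id _ _) braid_HA).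
Qed.

(** * The quasitriangular structure *)

Lemma tmulE (V V' : lmodType k) (m : V -> V -> V) (m' : V' -> V' -> V')
    v v' w w' :
  bilin m -> bilin m' -> tmul m m' (v ⊗ v') (w ⊗ w') = m v w ⊗ m' v' w'.
Proof. by move=> Hm Hm'; rewrite /tmul tsumE ?tsumE. Qed.

Lemma bilin_tmul (V V' : lmodType k) (m : V -> V -> V) (m' : V' -> V' -> V') :
  bilin m -> bilin m' -> bilin (tmul m m').
Proof. by move=> Hm Hm'; rewrite /tmul; multilin. Qed.

Lemma bilin_tsumE (V V' U U' M : lmodType k) (m : M -> M -> M) s t
    (F : V -> V' -> M) (G : U -> U' -> M) : bilin m ->
  m (tsum s F) (tsum t G) =
  \tsum[a, b <- s] \tsum[c, d <- t] m (F a b) (G c d).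
Proof.
move=> Hm; rewrite (lin_tsumE _ _ (bilin1 _ Hm)).
by apply: eq_tsum => a b; rewrite (lin_tsumE _ _ (bilin2 _ Hm)).
Qed.

(** The evaluated rules, taken at pure tensors of elements of H, are the
    axioms. *)
Theorem RHH_quasitriangular :
  is_quasitriangular (smash_mul sigma) (smash_one A B) Delta eps RHH.
Proof.
have bH := bilin_actH; have bHH := bilin_tmul bH bH.
have b3 := bilin_tmul bHH bH.
split.
- by split; [exact: RHH_counitl | exact: RHH_counitr].
- rewrite bilin_tsumE //.
  transitivity (\tsum[r1, r2 <- RHH] \tsum[h1, h2 <- Delta r1] (h1 ⊗ h2 ⊗ r2)).
    apply: eq_tsum => r1 r2; rewrite -{1}[Delta r1]tsum_id.
    by rewrite (lin_tsumE _ _ (lin_tpure1 _)).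
  rewrite RHH_comul1 //; do 2!apply: eq_tsum => ? ?.
  by rewrite !tmulE // smash_mul1l smash_mul1r.
- rewrite bilin_tsumE // RHH_comul2 //; do 2!apply: eq_tsum => ? ?.
  by rewrite !tmulE // smash_mul1l smash_mul1r.
- move=> h; rewrite -{1}[RHH]tsum_id -{1}[Delta h]tsum_id -{2}[RHH]tsum_id.
  rewrite !bilin_tsumE //.
  transitivity (\tsum[r1, r2 <- RHH] \tsum[h1, h2 <- Delta h]
    ((r1 ∙ h1) ⊗ (r2 ∙ h2))).
    by do 2!apply: eq_tsum => ? ?; rewrite tmulE.
  by rewrite braid_HH //; do 2!apply: eq_tsum => ? ?; rewrite tmulE.
Qed.

End Elements.
End Smash.

Theorem theorem3p6 (k : fieldType) (A B : algType k)
  (DeltaA : {linear A -> A ⨂ A}) (epsA : {scalar A})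
  (DeltaB : {linear B -> B ⨂ B}) (epsB : {scalar B})
  (sigma : {linear B ⨂ A -> A ⨂ B}) (tau : {linear A ⨂ B -> B ⨂ A})
  (W : B ⨂ B) (X : A ⨂ B) (Y : B ⨂ A) (Z : A ⨂ A)
  (smashH : smash_biproduct_bialgebra DeltaA epsA DeltaB epsB sigma tau)
  (conormal : right_conormal epsA sigma)
  (normW : normalized epsB epsB 1 1 W)
  (normX : normalized epsA epsB 1 1 X)
  (normY : normalized epsB epsA 1 1 Y)
  (normZ : normalized epsA epsA 1 1 Z)
  (C1 : forall a : A,
    \tsum[z1, z2 <- Z] \tsum[u1, u2 <- X] \tsum[x1, x2 <- X]
    \tsum[w1, w2 <- W] \tsum[y1, y2 <- Y] \tsum[a1, a2 <- DeltaA a]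
    \tsum[i1, z1t1 <- tau (z1 ⊗ 1)]
    \tsum[i2, z1t12 <- tau (z1t1 ⊗ 1)]
    \tsum[i3, u1t3 <- tau (u1 ⊗ 1)]
    \tsum[y2s1, u2s1 <- sigma (u2 ⊗ y2)]
    \tsum[y2s12, i1s2 <- sigma (i1 ⊗ y2s1)]
    \tsum[a1s3, w1y1s3 <- sigma ((w1 * y1) ⊗ a1)]
    \tsum[a2s4, p_s4 <- sigma ((i2 * i3 * x2 * w2) ⊗ a2)]
      (epsB w1y1s3 *: (z1t12 * u1t3 * x1 * a1s3))
        ⊗ (epsB (i1s2 * u2s1) *: (epsB p_s4 *: (z2 * y2s12 * a2s4)))
    = \tsum[z1, z2 <- Z] \tsum[a1, a2 <- DeltaA a]
      \tsum[i, a2t <- tau (a2 ⊗ 1)]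
      \tsum[z2s, is_ <- sigma (i ⊗ z2)]
        (a2t * z1) ⊗ (epsB is_ *: (a1 * z2s)))
  (C2 : forall a : A,
    \tsum[x1, x2 <- X] \tsum[w1, w2 <- W]
    \tsum[as_, w1s <- sigma (w1 ⊗ a)]
      (epsB w1s *: (x1 * as_)) ⊗ (x2 * w2)
    = \tsum[x1, x2 <- X] \tsum[i, at_ <- tau (a ⊗ 1)]
        (at_ * x1) ⊗ (i * x2))
  (C3 : forall a : A,
    \tsum[w1, w2 <- W] \tsum[y1, y2 <- Y]
    \tsum[i, at_ <- tau (a ⊗ 1)]
    \tsum[ats, w2s <- sigma (w2 ⊗ at_)]
      (w1 * y1 * i) ⊗ (epsB w2s *: (y2 * ats))
    = \tsum[y1, y2 <- Y] y1 ⊗ (a * y2))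
  (C4 : forall b : B,
    \tsum[z1, z2 <- Z] z1 ⊗ (epsB b *: z2)
    = \tsum[z1, z2 <- Z] \tsum[b1, b2 <- DeltaB b]
      \tsum[b1t, j <- tau (1 ⊗ b1)]
      \tsum[z1s1, b2s1 <- sigma (b2 ⊗ z1)]
      \tsum[z2s2, b1ts2 <- sigma (b1t ⊗ z2)]
        (j * z1s1) ⊗ (epsB b1ts2 *: (epsB b2s1 *: z2s2)))
  (C5 : forall b : B,
    \tsum[x1, x2 <- X] x1 ⊗ (x2 * b)
    = \tsum[x1, x2 <- X] \tsum[b1, b2 <- DeltaB b]
      \tsum[b1t, j <- tau (1 ⊗ b1)]
      \tsum[x1s, b2s <- sigma (b2 ⊗ x1)]
        (epsB b2s *: (j * x1s)) ⊗ (b1t * x2))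
  (C6 : forall b : B,
    \tsum[w1, w2 <- W] \tsum[y1, y2 <- Y]
    \tsum[bt, j <- tau (1 ⊗ b)]
    \tsum[js, w2s <- sigma (w2 ⊗ j)]
      (w1 * y1 * bt) ⊗ (epsB w2s *: (y2 * js))
    = \tsum[y1, y2 <- Y] \tsum[y2s, bs <- sigma (b ⊗ y2)]
        (bs * y1) ⊗ y2s)
  (C7 : forall b : B,
    \tsum[w1, w2 <- W] \tsum[b1, b2 <- DeltaB b] (w1 * b1) ⊗ (w2 * b2)
    = \tsum[w1, w2 <- W] \tsum[b1, b2 <- DeltaB b] (b2 * w1) ⊗ (b1 * w2))
  (C8 :
    \tsum[z1, z2 <- Z] \tsum[z11, z12 <- DeltaA z1] z11 ⊗ z12 ⊗ z2
    = \tsum[z1, z2 <- Z] \tsum[x1, x2 <- X] \tsum[v1, v2 <- Z]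
      \tsum[i, z1t <- tau (z1 ⊗ 1)]
      \tsum[v2s, ix2s <- sigma ((i * x2) ⊗ v2)]
        (z1t * x1) ⊗ v1 ⊗ (epsB ix2s *: (z2 * v2s)))
  (C9 :
    \tsum[x1, x2 <- X] \tsum[x11, x12 <- DeltaA x1] x11 ⊗ x12 ⊗ x2
    = \tsum[x1, x2 <- X] \tsum[u1, u2 <- X] x1 ⊗ u1 ⊗ (x2 * u2))
  (C10 :
    \tsum[z1, z2 <- Z] \tsum[x1, x2 <- X] \tsum[y1, y2 <- Y]
    \tsum[i, z1t2 <- tau (z1 ⊗ 1)]
    \tsum[y1t1, z1t2x1t1 <- tau ((z1t2 * x1) ⊗ y1)]
    \tsum[y2s, ix2s <- sigma ((i * x2) ⊗ y2)]
      y1t1 ⊗ z1t2x1t1 ⊗ (epsB ix2s *: (z2 * y2s))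
    = \tsum[w1, w2 <- W] \tsum[y1, y2 <- Y] \tsum[z1, z2 <- Z]
      \tsum[z2s, w2s <- sigma (w2 ⊗ z2)]
        (w1 * y1) ⊗ z1 ⊗ (epsB w2s *: (y2 * z2s)))
  (C11 :
    \tsum[w1, w2 <- W] \tsum[x1, x2 <- X]
    \tsum[w1t, x1t <- tau (x1 ⊗ w1)]
      w1t ⊗ x1t ⊗ (x2 * w2)
    = \tsum[w1, w2 <- W] \tsum[x1, x2 <- X] w1 ⊗ x1 ⊗ (w2 * x2))
  (C12 :
    \tsum[y1, y2 <- Y] \tsum[y11, y12 <- DeltaB y1] y11 ⊗ y12 ⊗ y2
    = \tsum[w1, w2 <- W] \tsum[y1, y2 <- Y] \tsum[v1, v2 <- Y]
      \tsum[v2s, w2s <- sigma (w2 ⊗ v2)]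
        (w1 * y1) ⊗ v1 ⊗ (epsB w2s *: (y2 * v2s)))
  (C13 :
    \tsum[w1, w2 <- W] \tsum[w11, w12 <- DeltaB w1] w11 ⊗ w12 ⊗ w2
    = \tsum[w1, w2 <- W] \tsum[v1, v2 <- W] w1 ⊗ v1 ⊗ (w2 * v2))
  (C14 :
    \tsum[z1, z2 <- Z] \tsum[z21, z22 <- DeltaA z2] z1 ⊗ z21 ⊗ z22
    = \tsum[z1, z2 <- Z] \tsum[x1, x2 <- X] \tsum[v1, v2 <- Z]
      \tsum[y1, y2 <- Y]
      \tsum[i, z1t <- tau (z1 ⊗ 1)]
      \tsum[v1s1, y1s1 <- sigma (y1 ⊗ v1)]
      \tsum[y2s2, ix2s2 <- sigma ((i * x2) ⊗ y2)]
        (epsB y1s1 *: (z1t * x1 * v1s1)) ⊗ v2 ⊗ (epsB ix2s2 *: (z2 * y2s2)))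
  (C15 :
    \tsum[z1, z2 <- Z] \tsum[x1, x2 <- X]
    \tsum[i, z1t1 <- tau (z1 ⊗ 1)]
    \tsum[ix2t2, z2t2 <- tau (z2 ⊗ (i * x2))]
      (z1t1 * x1) ⊗ ix2t2 ⊗ z2t2
    = \tsum[z1, z2 <- Z] \tsum[x1, x2 <- X] \tsum[u1, u2 <- X]
      \tsum[y1, y2 <- Y]
      \tsum[i, z1t <- tau (z1 ⊗ 1)]
      \tsum[u1s1, y1s1 <- sigma (y1 ⊗ u1)]
      \tsum[y2s2, ix2s2 <- sigma ((i * x2) ⊗ y2)]
        (epsB y1s1 *: (z1t * x1 * u1s1)) ⊗ u2 ⊗ (epsB ix2s2 *: (z2 * y2s2)))
  (C16 :
    \tsum[x1, x2 <- X] \tsum[x21, x22 <- DeltaB x2] x1 ⊗ x21 ⊗ x22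
    = \tsum[x1, x2 <- X] \tsum[u1, u2 <- X] \tsum[w1, w2 <- W]
      \tsum[u1s, w1s <- sigma (w1 ⊗ u1)]
        (epsB w1s *: (x1 * u1s)) ⊗ u2 ⊗ (x2 * w2))
  (C17 :
    \tsum[y1, y2 <- Y] \tsum[y21, y22 <- DeltaA y2] y1 ⊗ y21 ⊗ y22
    = \tsum[y1, y2 <- Y] \tsum[v1, v2 <- Y] (y1 * v1) ⊗ v2 ⊗ y2)
  (C18 :
    \tsum[w1, w2 <- W] \tsum[y1, y2 <- Y]
    \tsum[w2t, y2t <- tau (y2 ⊗ w2)]
      (w1 * y1) ⊗ w2t ⊗ y2t
    = \tsum[w1, w2 <- W] \tsum[y1, y2 <- Y] (y1 * w1) ⊗ w2 ⊗ y2)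
  (C19 :
    \tsum[w1, w2 <- W] \tsum[w21, w22 <- DeltaB w2] w1 ⊗ w21 ⊗ w22
    = \tsum[w1, w2 <- W] \tsum[v1, v2 <- W] (w1 * v1) ⊗ v2 ⊗ w2) :
  let alpha : (A ⨂ B) ⨂ (A ⨂ B) :=
    \tsum[z1, z2 <- Z] \tsum[u1, u2 <- X] \tsum[x1, x2 <- X]
    \tsum[w1, w2 <- W] \tsum[y1, y2 <- Y]
    \tsum[i1, z1t1 <- tau (z1 ⊗ 1)]
    \tsum[i2, z1t12 <- tau (z1t1 ⊗ 1)]
    \tsum[i3, u1t3 <- tau (u1 ⊗ 1)]
    \tsum[y2s1, u2s1 <- sigma (u2 ⊗ y2)]
    \tsum[y2s12, i1s2 <- sigma (i1 ⊗ y2s1)]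
      ((z1t12 * u1t3 * x1) ⊗ (w1 * y1))
        ⊗ ((epsB (i1s2 * u2s1) *: (z2 * y2s12)) ⊗ (i2 * i3 * x2 * w2)) in
  is_quasitriangular (smash_mul sigma) (smash_one A B)
    (smash_comul DeltaA DeltaB tau) (smash_counit epsA epsB) alpha.
Proof.
move=> alpha.
have -> : alpha = RHH epsB sigma W X Y Z.
  by rewrite -[RHS]tsum_id -(tsum_RHH_expanded smashH conormal Y Z normX
    C2 C9 C11 C13 C16 C19).
exact: (RHH_quasitriangular smashH conormal normW normX normY normZ
  C1 C2 C3 C4 C5 C6 C7 C8 C9 C10 C11 C12 C13 C14 C15 C16 C17 C18 C19).
Qed.
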